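(* Let $H$ be a bialgebra. Let $A$ be a left $H$-comodule coalgebra such that $\varepsilon_A(1_A)=1$, which is also an algebra with a left $H$-action $\triangleright$ making it a left $H$-module algebra. Let $B$ be a right $H$-comodule coalgebra such that $\varepsilon_B(1_B)=1$, which is also an algebra with a right $H$-action $\triangleleft$ making it a right $H$-module algebra. Then the two-sided smash product algebra $A\#H\#B$ equipped with the two-sided smash coproduct coalgebra $A\times H\times B$ becomes a bialgebra if and only if the following conditions hold for all $a,a'\in A$, $b,b'\in B$, $x\in H$: (C1) $\varepsilon_A$ and $\varepsilon_B$ are algebra maps; (C2) $\Delta_A(1_A)=1_A\otimes 1_A$, $\Delta_B(1_B)=1_B\otimes 1_B$; (C3) $1_{A(-1)}\otimes 1_{A(0)}=1_H\otimes 1_A$, $1_{B[0]}\otimes 1_{B[1]}=1_B\otimes 1_H$; (C4) $\varepsilon_A(x\triangleright a)=\varepsilon_A(a)\varepsilon_H(x)$, $\varepsilon_B(b\triangleleft x)=\varepsilon_B(b)\varepsilon_H(x)$; (D8) $(aa')_{(-1)}\otimes (aa')_{(0)}=a_{(-1)}a'_{(-1)}\otimes a_{(0)}a'_{(0)}$; (D10) $(bb')_{[0]}\otimes (bb')_{[1]}=b_{[0]}b'_{[0]}\otimes b_{[1]}b'_{[1]}$; (D16) $(x_1\triangleright a)_{(-1)}x_2\otimes (x_1\triangleright a)_{(0)}=x_1a_{(-1)}\otimes x_2\triangleright a_{(0)}$; (D17) $(b\triangleleft x_2)_{[0]}\otimes x_1(b\triangleleft x_2)_{[1]}=b_{[0]}\triangleleft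 x_1\otimes b_{[1]}x_2$; (D21) $b_{[1]}\triangleright a_{(0)}\otimes b_{[0]}\triangleleft a_{(-1)}=a\otimes b$; (F1) $(aa')_1\otimes (aa')_2=a_1(a_{2(-1)}\triangleright a'_1)\otimes a_{2(0)}a'_2$; (F2) $(bb')_1\otimes (bb')_2=b_1b'_{1[0]}\otimes (b_2\triangleleft b'_{1[1]})b'_2$; (F3) $(x\triangleright a)_1\otimes (x\triangleright a)_2=(x_1\triangleright a_1)\otimes (x_2\triangleright a_2)$; (F4) $(b\triangleleft x)_1\otimes (b\triangleleft x)_2=(b_1\triangleleft x_1)\otimes (b_2\triangleleft x_2)$.
   Context: Everything is over a field $K$. Comultiplications are written $\Delta(c)=c_1\otimes c_2$. The left coaction on $A$ is $a\mapsto a_{(-1)}\otimes a_{(0)}\in H\otimes A$, the right coaction on $B$ is $b\mapsto b_{[0]}\otimes b_{[1]}\in B\otimes H$; subscripts are read left to right, e.g. $a_{2(-1)}\otimes a_{2(0)}$ is the coaction of $a_2$. A left $H$-comodule coalgebra is a coalgebra that is a left $H$-comodule whose comultiplication and counit are comodule maps ($a_{(-1)}\otimes a_{(0)1}\otimes a_{(0)2}=a_{1(-1)}a_{2(-1)}\otimes a_{1(0)}\otimes a_{2(0)}$, $a_{(-1)}\varepsilon(a_{(0)})=\varepsilon(a)1_H$); right comodule coalgebras are defined analogously. Two-sided smash product $A\#H\#B$: the space $A\otimes H\otimes B$ with unit $1_A\otimes 1_H\otimes 1_B$ and multiplication $(a\otimes x\otimes b)(a'\otimes x'\otimes b')=a(x_1\triangleright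 a')\otimes x_2x'_1\otimes (b\triangleleft x'_2)b'$. Two-sided smash coproduct $A\times H\times B$: the space $A\otimes H\otimes B$ with counit $\varepsilon_A\otimes\varepsilon_H\otimes\varepsilon_B$ and comultiplication $\Delta(a\otimes x\otimes b)=a_1\otimes a_{2(-1)}x_1\otimes b_{1[0]}\otimes a_{2(0)}\otimes x_2b_{1[1]}\otimes b_2$. *)

(* Defs.v *)
From HB Require Import structures.
From mathcomp Require Import all_boot all_order all_algebra.
From mathcomp Require Import boolp.

Set Implicit Arguments.
Unset Strict Implicit.
Unset Printing Implicit Defensive.

Import GRing.Theory.
Local Open Scope ring_scope.
Local Open Scope quotient_scope.

Reserved Notation "x ⊗ y" (at level 45, left associativity).
Reserved Notation "\sw_ ( x , y <- t ) E"
  (at level 47, x name, y name, t at level 50, E at level 47,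
   format "\sw_ ( x ,  y  <-  t )  E").

Notation bilinear2 f := (bilinear_for *:%R *:%R f).

(** * Tensor product of two (possibly infinite-dimensional) vector spaces.

    A tensor is a class of formal sums [(v_1, w_1); ...; (v_n, w_n)], two of
    which are identified when no bilinear map separates them: this is the
    kernel of the universal bilinear map.  The universal property is
    [bilinear2_pure], [linear_sweedler], [sweedler_pure], [tens_linear_eq]. *)

Section Tensor.
Variables (K : fieldType) (V W : lmodType K).

Definition fsum (U : lmodType K) (f : V -> W -> U) (s : seq (V * W)) : U :=
  \sum_(p <- s) f p.1 p.2.

Definition tens_eq : rel (seq (V * W)) := fun s t =>
  `[< forall (U : lmodType K) (f : V -> W -> U),
        bilinear2 f -> fsum f s = fsum f t >].

Lemma tens_eq_refl : reflexive tens_eq.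
Proof. by move=> s; apply/asboolP. Qed.

Lemma tens_eq_sym : symmetric tens_eq.
Proof.
by move=> s t; apply/asboolP/asboolP => e U f bf; rewrite (e U f bf).
Qed.

Lemma tens_eq_trans : transitive tens_eq.
Proof.
move=> t s u /asboolP e1 /asboolP e2; apply/asboolP => U f bf.
by rewrite (e1 U f bf) (e2 U f bf).
Qed.

Canonical tens_equiv := EquivRel tens_eq tens_eq_refl tens_eq_sym tens_eq_trans.

Definition tens : Type := {eq_quot tens_equiv}.
HB.instance Definition _ := Choice.on tens.
HB.instance Definition _ := Quotient.on tens.

Definition tpure (v : V) (w : W) : tens := \pi_tens [:: (v, w)].

(* Sweedler summation: sum of [f v w] over a representation of [t] as a finite
   sum of pure tensors [v ⊗ w].  For bilinear [f] the choice of representation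
   is irrelevant ([sweedler_pi]) and this is the linear map induced by [f]. *)
Definition sweedler (U : lmodType K) (f : V -> W -> U) (t : tens) : U :=
  fsum f (repr t).

Lemma sweedler_pi (U : lmodType K) (f : V -> W -> U) (s : seq (V * W)) :
  bilinear2 f -> sweedler f (\pi_tens s) = fsum f s.
Proof.
move=> bf; rewrite /sweedler.
have /eqquotP /asboolP /(_ U f bf) // : repr (\pi_tens s) = s %[mod tens].
by rewrite reprK.
Qed.

Lemma tens_ext (t u : tens) :
  (forall (U : lmodType K) (f : V -> W -> U),
     bilinear2 f -> sweedler f t = sweedler f u) -> t = u.
Proof.
move=> e; rewrite -[t]reprK -[u]reprK; apply/eqquotP/asboolP => U f bf.
exact: e.
Qed.

Definition tens_zero : tens := \pi_tens [::].
Definition tens_add (t u : tens) : tens := \pi_tens (repr t ++ repr u).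
Definition tens_scale (a : K) (t : tens) : tens :=
  \pi_tens [seq (a *: p.1, p.2) | p <- repr t].
Definition tens_opp (t : tens) : tens := tens_scale (-1) t.

Section Eval.
Variables (U : lmodType K) (f : V -> W -> U) (bf : bilinear2 f).

Lemma sweedler_zero : sweedler f tens_zero = 0.
Proof. by rewrite sweedler_pi // /fsum big_nil. Qed.

Lemma sweedler_add t u : sweedler f (tens_add t u) = sweedler f t + sweedler f u.
Proof. by rewrite sweedler_pi // /fsum big_cat. Qed.

Lemma sweedler_scale a t : sweedler f (tens_scale a t) = a *: sweedler f t.
Proof.
rewrite sweedler_pi // /sweedler /fsum big_map scaler_sumr.
by apply: eq_bigr => p _; rewrite (scalable_linear (bf.1 _)).
Qed.

Lemma sweedler_opp t : sweedler f (tens_opp t) = - sweedler f t.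
Proof. by rewrite sweedler_scale scaleN1r. Qed.

End Eval.

Fact tens_addA : associative tens_add.
Proof. by move=> t u v; apply: tens_ext => U f bf; rewrite !sweedler_add // addrA. Qed.

Fact tens_addC : commutative tens_add.
Proof. by move=> t u; apply: tens_ext => U f bf; rewrite !sweedler_add // addrC. Qed.

Fact tens_add0 : left_id tens_zero tens_add.
Proof.
by move=> t; apply: tens_ext => U f bf; rewrite sweedler_add // sweedler_zero // add0r.
Qed.

Fact tens_addN : left_inverse tens_zero tens_opp tens_add.
Proof.
move=> t; apply: tens_ext => U f bf.
by rewrite sweedler_add // sweedler_zero // sweedler_opp // addNr.
Qed.

HB.instance Definition _ :=
  GRing.isZmodule.Build tens tens_addA tens_addC tens_add0 tens_addN.

Fact tens_scaleA a b (t : tens) :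
  tens_scale a (tens_scale b t) = tens_scale (a * b) t.
Proof. by apply: tens_ext => U f bf; rewrite !sweedler_scale // scalerA. Qed.

Fact tens_scale1 : left_id 1 tens_scale.
Proof. by move=> t; apply: tens_ext => U f bf; rewrite sweedler_scale // scale1r. Qed.

Fact tens_scaleDr : right_distributive tens_scale +%R.
Proof.
move=> a t u; apply: tens_ext => U f bf.
by rewrite sweedler_scale // !sweedler_add // !sweedler_scale // scalerDr.
Qed.

Fact tens_scaleDl t : {morph tens_scale^~ t : a b / a + b}.
Proof.
move=> a b; apply: tens_ext => U f bf.
by rewrite sweedler_add // !sweedler_scale // scalerDl.
Qed.

HB.instance Definition _ := GRing.Zmodule_isLmodule.Build K tens
  tens_scaleA tens_scale1 tens_scaleDr tens_scaleDl.

Lemma linear_sweedler (U : lmodType K) (f : V -> W -> U) :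
  bilinear2 f -> linear (sweedler f).
Proof.
by move=> bf a t u; rewrite [LHS]sweedler_add // [X in X + _]sweedler_scale.
Qed.

Lemma sweedler_pure (U : lmodType K) (f : V -> W -> U) v w :
  bilinear2 f -> sweedler f (tpure v w) = f v w.
Proof. by move=> bf; rewrite sweedler_pi // /fsum big_seq1. Qed.

Lemma bilinear2_pure : bilinear2 tpure.
Proof.
by split=> [w a v v' | v a w w']; apply: tens_ext => U f bf;
  rewrite linear_sweedler // !sweedler_pure // ?bf.1 ?bf.2.
Qed.

Lemma tens_sum_pure (t : tens) : t = \sum_(p <- repr t) tpure p.1 p.2.
Proof.
apply: tens_ext => U f bf; rewrite {1}/sweedler /fsum.
elim: (repr t) => [|p s IHs]; first by rewrite !big_nil sweedler_zero.
rewrite !big_cons IHs -[tpure p.1 p.2]scale1r linear_sweedler // scale1r.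
by rewrite sweedler_pure.
Qed.

Lemma tens_linear_eq (U : lmodType K) (g h : tens -> U) :
    linear g -> linear h ->
  (forall v w, g (tpure v w) = h (tpure v w)) -> g =1 h.
Proof.
move=> lg lh e t; rewrite [t]tens_sum_pure.
have lin0 (k : tens -> U) : linear k -> k 0 = 0.
  by move=> lk; have := lk (-1) 0 0; rewrite addr0 scaler0 scaleN1r addNr.
elim: (repr t) => [|p s IHs]; first by rewrite !big_nil !lin0.
by rewrite !big_cons -[tpure p.1 p.2]scale1r lg lh e IHs.
Qed.

End Tensor.

Arguments tens {K} V W.
Arguments tpure {K V W} v w.
Arguments sweedler {K V W U} f t.

Notation "V ⊗ W" := (tens V%type W%type) : type_scope.
Notation "v ⊗ w" := (tpure v w) : ring_scope.
Notation "\sw_ ( x , y <- t ) E" := (sweedler (fun x y => E) t) : ring_scope.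

(** * Algebras, coalgebras and bialgebras, given by their operations *)

Section Structures.
Variable K : fieldType.

Record is_algebra (V : lmodType K) (one : V) (mul : V -> V -> V) : Prop := {
  algebra_bilinear : bilinear2 mul;
  algebra_mulA : associative mul;
  algebra_mul1 : left_id one mul;
  algebra_mulr1 : right_id one mul
}.

Record is_algebra_map (V W : lmodType K) (oneV : V) (mulV : V -> V -> V)
    (oneW : W) (mulW : W -> W -> W) (f : V -> W) : Prop := {
  algebra_map_linear : linear f;
  algebra_map_one : f oneV = oneW;
  algebra_map_mul : {morph f : x y / mulV x y >-> mulW x y}
}.

(* Multiplication of the algebra V ⊗ V. *)
Definition tens_mul (V : lmodType K) (mul : V -> V -> V)
    (s t : V ⊗ V) : V ⊗ V :=
  \sw_(x1, x2 <- s) \sw_(y1, y2 <- t) mul x1 y1 ⊗ mul x2 y2.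

Record is_coalgebra (V : lmodType K) (Delta : V -> V ⊗ V) (eps : V -> K^o)
    : Prop := {
  coalgebra_Delta_linear : linear Delta;
  coalgebra_eps_linear : linear eps;
  coalgebra_coassoc : forall c,
    \sw_(c1, c2 <- Delta c) \sw_(c11, c12 <- Delta c1) c11 ⊗ c12 ⊗ c2
    = \sw_(c1, c2 <- Delta c) \sw_(c21, c22 <- Delta c2) c1 ⊗ c21 ⊗ c22;
  coalgebra_counitl : forall c, \sw_(c1, c2 <- Delta c) eps c1 *: c2 = c;
  coalgebra_counitr : forall c, \sw_(c1, c2 <- Delta c) eps c2 *: c1 = c
}.

Record is_bialgebra (V : lmodType K) (one : V) (mul : V -> V -> V)
    (Delta : V -> V ⊗ V) (eps : V -> K^o) : Prop := {
  bialgebra_algebra : is_algebra one mul;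
  bialgebra_coalgebra : is_coalgebra Delta eps;
  bialgebra_Delta : is_algebra_map one mul (one ⊗ one) (tens_mul mul) Delta;
  bialgebra_eps : is_algebra_map one mul (1 : K^o) *%R eps
}.

(** * Module algebras and comodule coalgebras over H *)

Variables (H : algType K) (DeltaH : H -> H ⊗ H) (epsH : H -> K^o).

Record is_left_module_algebra (A : algType K) (act : H -> A -> A) : Prop := {
  lmodalg_bilinear : bilinear2 act;
  lmodalg_act1 : forall a, act 1 a = a;
  lmodalg_actM : forall x y a, act (x * y) a = act x (act y a);
  lmodalg_act_mul : forall x a a',
    act x (a * a') = \sw_(x1, x2 <- DeltaH x) act x1 a * act x2 a';
  lmodalg_act_one : forall x, act x 1 = epsH x *: 1
}.

Record is_right_module_algebra (B : algType K) (act : B -> H -> B) : Prop := {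
  rmodalg_bilinear : bilinear2 act;
  rmodalg_act1 : forall b, act b 1 = b;
  rmodalg_actM : forall b x y, act b (x * y) = act (act b x) y;
  rmodalg_act_mul : forall b b' x,
    act (b * b') x = \sw_(x1, x2 <- DeltaH x) act b x1 * act b' x2;
  rmodalg_act_one : forall x, act 1 x = epsH x *: 1
}.

Record is_left_comodule (A : lmodType K) (rho : A -> H ⊗ A) : Prop := {
  lcomod_linear : linear rho;
  lcomod_coassoc : forall a,
    \sw_(h, a0 <- rho a) \sw_(h1, h2 <- DeltaH h) h1 ⊗ h2 ⊗ a0
    = \sw_(h, a0 <- rho a) \sw_(h', a00 <- rho a0) h ⊗ h' ⊗ a00;
  lcomod_counit : forall a, \sw_(h, a0 <- rho a) epsH h *: a0 = a
}.

Record is_right_comodule (B : lmodType K) (rho : B -> B ⊗ H) : Prop := {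
  rcomod_linear : linear rho;
  rcomod_coassoc : forall b,
    \sw_(b0, h <- rho b) \sw_(b00, h' <- rho b0) b00 ⊗ h' ⊗ h
    = \sw_(b0, h <- rho b) \sw_(h1, h2 <- DeltaH h) b0 ⊗ h1 ⊗ h2;
  rcomod_counit : forall b, \sw_(b0, h <- rho b) epsH h *: b0 = b
}.

Record is_left_comodule_coalgebra (A : lmodType K) (Delta : A -> A ⊗ A)
    (eps : A -> K^o) (rho : A -> H ⊗ A) : Prop := {
  lcomodcoalg_coalgebra : is_coalgebra Delta eps;
  lcomodcoalg_comodule : is_left_comodule rho;
  lcomodcoalg_Delta : forall a,
    \sw_(h, a0 <- rho a) \sw_(a01, a02 <- Delta a0) h ⊗ a01 ⊗ a02
    = \sw_(a1, a2 <- Delta a) \sw_(h1, a10 <- rho a1) \sw_(h2, a20 <- rho a2)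
        (h1 * h2) ⊗ a10 ⊗ a20;
  lcomodcoalg_eps : forall a, \sw_(h, a0 <- rho a) eps a0 *: h = eps a *: 1
}.

Record is_right_comodule_coalgebra (B : lmodType K) (Delta : B -> B ⊗ B)
    (eps : B -> K^o) (rho : B -> B ⊗ H) : Prop := {
  rcomodcoalg_coalgebra : is_coalgebra Delta eps;
  rcomodcoalg_comodule : is_right_comodule rho;
  rcomodcoalg_Delta : forall b,
    \sw_(b0, h <- rho b) \sw_(b01, b02 <- Delta b0) b01 ⊗ b02 ⊗ h
    = \sw_(b1, b2 <- Delta b) \sw_(b10, h1 <- rho b1) \sw_(b20, h2 <- rho b2)
        b10 ⊗ b20 ⊗ (h1 * h2);
  rcomodcoalg_eps : forall b, \sw_(b0, h <- rho b) eps b0 *: h = eps b *: 1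
}.

(** * Two-sided smash product A # H # B and smash coproduct A × H × B

    The underlying space A ⊗ H ⊗ B is (A ⊗ H) ⊗ B. *)

Variables A B : algType K.

Definition smash_one : A ⊗ H ⊗ B := 1 ⊗ 1 ⊗ 1.

Definition smash_mul (actA : H -> A -> A) (actB : B -> H -> B)
    (s t : A ⊗ H ⊗ B) : A ⊗ H ⊗ B :=
  \sw_(ax, b <- s) \sw_(a, x <- ax) \sw_(ax', b' <- t) \sw_(a', x' <- ax')
  \sw_(x1, x2 <- DeltaH x) \sw_(x1', x2' <- DeltaH x')
    (a * actA x1 a') ⊗ (x2 * x1') ⊗ (actB b x2' * b').

Definition smash_Delta (DeltaA : A -> A ⊗ A) (rhoA : A -> H ⊗ A)
    (DeltaB : B -> B ⊗ B) (rhoB : B -> B ⊗ H)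
    (t : A ⊗ H ⊗ B) : (A ⊗ H ⊗ B) ⊗ (A ⊗ H ⊗ B) :=
  \sw_(ax, b <- t) \sw_(a, x <- ax)
  \sw_(a1, a2 <- DeltaA a) \sw_(a2m, a20 <- rhoA a2)
  \sw_(x1, x2 <- DeltaH x)
  \sw_(b1, b2 <- DeltaB b) \sw_(b10, b11 <- rhoB b1)
    (a1 ⊗ (a2m * x1) ⊗ b10) ⊗ (a20 ⊗ (x2 * b11) ⊗ b2).

Definition smash_eps (epsA : A -> K^o) (epsB : B -> K^o)
    (t : A ⊗ H ⊗ B) : K^o :=
  \sw_(ax, b <- t) \sw_(a, x <- ax) epsA a * epsH x * epsB b.

End Structures.

Arguments smash_one {K H A B}.

(* Main.v *)
Require Import Defs.
From HB Require Import structures.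
From mathcomp Require Import all_boot all_order all_algebra.
From mathcomp Require Import boolp ring.

(** The space A ⊗ H ⊗ B is an algebra and a coalgebra on the sole strength of
    the module and comodule hypotheses ([smash_algebra], [smash_coalgebra]), so
    everything turns on whether its coproduct and counit are algebra maps.

    The smash product is generated by the copies of A, H and B, since
    [a ⊗ x ⊗ b] is the product of [a ⊗ 1 ⊗ 1], [1 ⊗ x ⊗ 1] and [1 ⊗ 1 ⊗ b], and the
    smash coproduct factors accordingly in the tensor square of the algebra:
    [Delta (a ⊗ x ⊗ b) = cogenA a ∗∗ cogenH x ∗∗ cogenB b] ([Delta_factor]).  When
    the units are grouplike and coinvariant, the three factors are the
    coproducts of the generators.  So [Delta] is multiplicative exactly when the
    factors satisfy the relations that the generators satisfy in the smash
    product: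
    - [cogenA a ∗∗ cogenA a' = cogenA (a * a')], and likewise for B and H;
    - [cogenH x ∗∗ cogenA a = \sum cogenA (x_1 ▷ a) ∗∗ cogenH x_2];
    - [cogenB b ∗∗ cogenH x = \sum cogenH x_1 ∗∗ cogenB (b ◁ x_2)];
    - [cogenB b ∗∗ cogenA a = cogenA a ∗∗ cogenB b].

    The relation for products in A encodes the formulas for the coproduct and
    for the coaction of [a * a']; the one that moves H past A encodes the
    formulas for the coproduct and for the coaction of [x ▷ a]; B behaves in the
    mirrored way; and the last relation says that the cross action of the
    coactions is trivial.

    From the conditions to the bialgebra: the formulas reduce each relation to
    coassociativity of H or of the coactions.  The elements [u] with
    [Delta (u * v) = Delta u * Delta v] for all [v] are closed under products,
    so it is enough that they include the generators ([smash_Delta_mul]).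

    From the bialgebra to the conditions: each relation is an equation between
    tensors with six factors, and applying counits to four of them leaves one
    of the conditions, the choice of the surviving pair selecting which one.
    The counit being an algebra map and the coproduct of the unit provide the
    remaining conditions. *)

Set Implicit Arguments.
Unset Strict Implicit.
Unset Printing Implicit Defensive.

Import GRing.Theory.
Local Open Scope ring_scope.

(** * Linearity of Sweedler expressions *)

Section Linear.
Variables (K : fieldType) (U V W : lmodType K).

Lemma linear_id : linear (fun x : U => x). Proof. by []. Qed.

Lemma linear_comp (g : V -> W) (f : U -> V) :
  linear g -> linear f -> linear (fun x => g (f x)).
Proof. by move=> lg lf a x y; rewrite lf lg. Qed.

Lemma linear_scaled (f : U -> V) (c : K) u : linear f -> f (c *: u) = c *: f u.
Proof. by move=> lf; apply: (scalable_linear (s := *:%R) lf). Qed.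

Lemma linear_scale (c : K) : linear (fun x : U => c *: x).
Proof. by move=> a x y; rewrite scalerDr !scalerA mulrC. Qed.

Lemma linear_scalel (v : U) : linear (fun c : K^o => (c : K) *: v).
Proof. by move=> a x y; rewrite scalerDl scalerA. Qed.

Lemma linear_purel (w : W) : linear (fun v : V => v ⊗ w).
Proof. exact: (bilinear2_pure V W).1. Qed.

Lemma linear_purer (v : V) : linear (fun w : W => v ⊗ w).
Proof. exact: (bilinear2_pure V W).2. Qed.

Lemma linear_sum (I : Type) (r : seq I) (g : U -> V) (f : I -> U) : linear g ->
  g (\sum_(i <- r) f i) = \sum_(i <- r) g (f i).
Proof.
move=> lg; elim: r => [|i r IH].
  by rewrite !big_nil; have := lg (-1) 0 0; rewrite addr0 scaler0 scaleN1r addNr.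
by rewrite !big_cons -IH -{1}[f i]scale1r lg scale1r.
Qed.

End Linear.

Section LinearMul.
Variables (K : fieldType) (R : algType K).
Lemma linear_mull (c : R) : linear (fun x : R => x * c).
Proof. by move=> a x y; rewrite mulrDl scalerAl. Qed.
Lemma linear_mulr (c : R) : linear (fun x : R => c * x).
Proof. by move=> a x y; rewrite mulrDr scalerAr. Qed.
End LinearMul.

Section Sweedler.
Variables (K : fieldType) (V W : lmodType K).

(** A Sweedler sum is a finite sum over a fixed representative of [t], so
    linearity of each summand is enough. *)
Lemma linear_sweedlerF (U X : lmodType K) (F : X -> V -> W -> U) (t : V ⊗ W) :
  (forall v w, linear (fun x => F x v w)) ->
  linear (fun x => \sw_(v, w <- t) F x v w).
Proof.
move=> lF a x y; rewrite /sweedler /fsum scaler_sumr -big_split /=.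
by apply: eq_bigr => p _; rewrite lF.
Qed.

Lemma eq_sweedler (U : lmodType K) (F G : V -> W -> U) (t : V ⊗ W) :
  (forall v w, F v w = G v w) -> sweedler F t = sweedler G t.
Proof. by move=> e; apply: eq_bigr => p _. Qed.

Lemma linear_of_sweedler (U X : lmodType K) (g : U -> X) (F : V -> W -> U) (t : V ⊗ W) :
  linear g -> g (sweedler F t) = \sw_(v, w <- t) g (F v w).
Proof. by move=> lg; rewrite /sweedler /fsum linear_sum. Qed.

(** Both sides are finite double sums over fixed representatives. *)
Lemma sweedler_exchange (U V' W' : lmodType K) (F : V -> W -> V' -> W' -> U)
    (s : V ⊗ W) (t : V' ⊗ W') :
  \sw_(x, y <- s) \sw_(u, v <- t) F x y u v =
  \sw_(u, v <- t) \sw_(x, y <- s) F x y u v.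
Proof. exact: exchange_big. Qed.

Lemma sweedler_eta (t : V ⊗ W) : \sw_(v, w <- t) v ⊗ w = t.
Proof. by rewrite [RHS]tens_sum_pure. Qed.

Lemma sweedler_scaler (U : lmodType K) (k : K) (F : V -> W -> U) (t : V ⊗ W) :
  \sw_(v, w <- t) (k *: F v w) = k *: sweedler F t.
Proof. by rewrite [RHS](linear_of_sweedler _ _ (linear_scale k)). Qed.

Lemma sweedler_sweedler (U V' W' : lmodType K) (F : V' -> W' -> U)
   (G : V -> W -> V' ⊗ W') (t : V ⊗ W) : bilinear2 F ->
  sweedler F (sweedler G t) = \sw_(v, w <- t) sweedler F (G v w).
Proof. by move=> bF; rewrite linear_of_sweedler //; apply: linear_sweedler. Qed.

End Sweedler.

Definition trilinear (K : fieldType) (V1 V2 V3 U : lmodType K)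
    (F : V1 -> V2 -> V3 -> U) : Prop :=
  [/\ forall y z, linear (fun x => F x y z), forall x z, linear (fun y => F x y z)
    & forall x y, linear (fun z => F x y z)].

Section Trilinear.
Variables (K : fieldType) (V1 V2 V3 U : lmodType K) (F : V1 -> V2 -> V3 -> U).
Hypothesis tF : trilinear F.
Lemma trilinear1 y z : linear (fun x => F x y z). Proof. by case: tF. Qed.
Lemma trilinear2 x z : linear (fun y => F x y z). Proof. by case: tF. Qed.
Lemma trilinear3 x y : linear (fun z => F x y z). Proof. by case: tF. Qed.
End Trilinear.

Lemma bilinear_left (K : fieldType) (V W U : lmodType K) (F : V -> W -> U) :
  bilinear2 F -> forall w, linear (fun v => F v w).
Proof. by move=> bF w; apply: bF.1. Qed.
Lemma bilinear_right (K : fieldType) (V W U : lmodType K) (F : V -> W -> U) :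
  bilinear2 F -> forall v, linear (fun w => F v w).
Proof. by move=> bF w; apply: bF.2. Qed.

Definition pentalinear (K : fieldType) (V1 V2 V3 V4 V5 U : lmodType K)
    (F : V1 -> V2 -> V3 -> V4 -> V5 -> U) : Prop :=
  [/\ forall x2 x3 x4 x5, linear (fun x => F x x2 x3 x4 x5),
      forall x1 x3 x4 x5, linear (fun x => F x1 x x3 x4 x5),
      forall x1 x2 x4 x5, linear (fun x => F x1 x2 x x4 x5),
      forall x1 x2 x3 x5, linear (fun x => F x1 x2 x3 x x5)
    & forall x1 x2 x3 x4, linear (fun x => F x1 x2 x3 x4 x)].

Section Pentalinear.
Variables (K : fieldType) (V1 V2 V3 V4 V5 U : lmodType K).
Variable (F : V1 -> V2 -> V3 -> V4 -> V5 -> U).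
Hypothesis pF : pentalinear F.
Lemma pentalinear1 x2 x3 x4 x5 : linear (fun x => F x x2 x3 x4 x5).
Proof. by case: pF. Qed.
Lemma pentalinear2 x1 x3 x4 x5 : linear (fun x => F x1 x x3 x4 x5).
Proof. by case: pF. Qed.
Lemma pentalinear3 x1 x2 x4 x5 : linear (fun x => F x1 x2 x x4 x5).
Proof. by case: pF. Qed.
Lemma pentalinear4 x1 x2 x3 x5 : linear (fun x => F x1 x2 x3 x x5).
Proof. by case: pF. Qed.
Lemma pentalinear5 x1 x2 x3 x4 : linear (fun x => F x1 x2 x3 x4 x).
Proof. by case: pF. Qed.
End Pentalinear.

(** The linear operations of the current structure, added by redefinition once
    its hypotheses are fixed. *)
Ltac linear_op := fail.

Ltac lin_hyp :=
  match goal with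
  | H : trilinear ?F |- _ =>
      first [ refine (linear_comp (trilinear1 H _ _) _)
            | refine (linear_comp (trilinear2 H _ _) _)
            | refine (linear_comp (trilinear3 H _ _) _) ]
  | H : pentalinear ?F |- _ =>
      first [ refine (linear_comp (pentalinear1 H _ _ _ _) _)
            | refine (linear_comp (pentalinear2 H _ _ _ _) _)
            | refine (linear_comp (pentalinear3 H _ _ _ _) _)
            | refine (linear_comp (pentalinear4 H _ _ _ _) _)
            | refine (linear_comp (pentalinear5 H _ _ _ _) _) ]
  | H : bilinear_for _ _ ?F |- _ =>
      first [ refine (linear_comp (bilinear_left H _) _)
            | refine (linear_comp (bilinear_right H _) _) ]
  | H : GRing.linear_for _ ?F |- _ => refine (linear_comp H _)
  end.

(** Decides multilinearity of an expression in which every variable occurs once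
    per monomial, by following the path from the variable to the root.  The
    bare heads at the end are what unification leaves after eta-contraction. *)
Ltac lin :=
  cbv beta;
  lazymatch goal with
  | |- GRing.linear_for _ ?f =>
      lazymatch f with
      | fun x => x => exact: linear_id
      | fun x => sweedler _ _ =>
          first [ refine (linear_sweedlerF _ _); intros ? ?
                | refine (linear_comp (linear_sweedler _) _) ]; lin
      | fun x => _ ⊗ _ =>
          first [ refine (linear_comp (linear_purel _) _)
                | refine (linear_comp (linear_purer _) _) ]; lin
      | fun x => _ * _ =>
          first [ refine (linear_comp (linear_mull _) _)
                | refine (linear_comp (linear_mulr _) _) ]; lin
      | fun x => _ *: _ =>
          first [ refine (linear_comp (linear_scale _) _)
                | refine (linear_comp (linear_scalel _) _) ]; lin
      | GRing.mul ?c => exact: linear_mulr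
      | GRing.scale ?c => exact: linear_scale
      | tpure ?c => exact: linear_purer
      | sweedler _ => apply: linear_sweedler; lin
      | _ => first [ assumption | first [ linear_op | lin_hyp ]; lin ]
      end
  | |- bilinear_for _ _ _ => split; intros ?; lin
  | |- trilinear _ => split; intros ? ?; lin
  | |- pentalinear _ => split; intros ? ? ? ?; lin
  end.

(** * Computing with nested Sweedler sums *)

(** The sum over [t] moves outermost by exchanging it with each sum around it,
    so [t] must not depend on their variables. *)
Ltac pull t :=
  lazymatch goal with
  | |- sweedler ?F t = _ => reflexivity
  | |- sweedler ?F ?s = _ =>
      refine (etrans (eq_sweedler _ _) (sweedler_exchange _ _ _)); intros; cbv beta; pull t
  end.

(** Pairs the sums of the two sides, whatever their order, down to an equation
    between summands. *)
Ltac match_sw :=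
  cbv beta;
  lazymatch goal with
  | |- sweedler ?F ?t = sweedler ?G ?t => refine (eq_sweedler _ _); intros; match_sw
  | |- sweedler ?F ?t = sweedler _ _ =>
     refine (etrans _ (esym _)); [ | pull t ]; match_sw
  | |- _ => idtac
  end.

(** Expands the subterm [t] by [pf : t = \sw ...] and moves the resulting sum to
    the root, which is legitimate because [t] sits in a linear position. *)
Ltac nf_expand t pf :=
  lazymatch goal with |- ?E = _ =>
    let E' := eval pattern t in E in
    lazymatch E' with ?g _ =>
      refine (etrans (congr1 g pf) _);
      refine (etrans (linear_of_sweedler (g := g) _ _ _) _); [lin | ] end end.

(** Rewriting rules of the current structure: [nf_atom] for the tensors summed
    over, [nf_leaf] for the summands, [nf_sum] for sums that collapse, such as
    those removed by a counit. *)
Ltac nf_atom := fail.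
Ltac nf_leaf := fail.
Ltac nf_sum := fail.

(** Brings the left-hand side of an equation to a nest of sums over tensors that
    no rule expands.  The right-hand side is normally an existential variable,
    instantiated by the normal form. *)
Ltac nf :=
  cbv beta;
  lazymatch goal with
  | |- sweedler ?F (_ ⊗ _) = _ =>
     refine (etrans (sweedler_pure _ _ _) _); [lin | nf]
  | |- sweedler ?F (sweedler _ _) = _ =>
     refine (etrans (sweedler_sweedler _ _ _) _); [lin | nf]
  | |- sweedler ?F ?t = _ =>
     first [ (refine (etrans (congr1 (sweedler F) _) _); [nf_atom | nf])
           | refine (etrans (eq_sweedler _ _) _);
             [ intros ? ?; nf | cbv beta; first [ nf_sum; nf | reflexivity ] ] ]
  | |- @GRing.scale ?R ?U ?k (sweedler _ _) = _ =>
     refine (etrans (congr1 (@GRing.scale R U k) _) _);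
     [ nf | first [ nf_leaf; nf | reflexivity ] ]
  | |- _ *: _ = _ => first [ nf_leaf; nf | reflexivity ]
  | |- context [sweedler ?F ?t] => nf_expand (sweedler F t) (erefl (sweedler F t)); nf
  | |- _ => first [ nf_leaf; nf | reflexivity ]
  end.

(** Makes the sum over [t] outermost and continues with [k] on its summand; nested
    uses put the sums in a prescribed order. *)
Ltac bring t k :=
  etransitivity;
  [ pull t
  | refine (eq_sweedler _ _);
    let u := fresh "u" in let v := fresh "v" in intros u v; cbv beta; k u v ].

Ltac at_leaf k :=
  lazymatch goal with
  | |- sweedler _ _ = _ => refine (eq_sweedler _ _); intros ? ?; cbv beta; at_leaf k
  | |- _ => k
  end.

(** A product of counits is split in reverse because [nf_sum] removes the innermost
    sum first and looks for its counit at the head of the summand. *)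
Lemma scaler_mul_rev (K : fieldType) (V : lmodType K) (k l : K) (v : V) :
  (k * l) *: v = l *: (k *: v).
Proof. by rewrite scalerA mulrC. Qed.

(** Proves an equation from [E], which it equals up to normal forms. *)
Ltac nf_from E := refine (etrans (esym _) (etrans E _)); nf.

(** * Coalgebras and comodules, tested against multilinear maps *)

(** An axiom stated as an equation of tensors is usable inside a Sweedler
    computation only after both sides have been fed to an arbitrary multilinear
    map; the lemmas of this part are the axioms in that form. *)
Section Coalgebra.
Variables (K : fieldType) (V : lmodType K) (D : V -> V ⊗ V) (eps : V -> K^o).
Hypothesis coV : is_coalgebra D eps.

Lemma coassoc_sweedler (U : lmodType K) (F : V -> V -> V -> U) c : trilinear F ->
  \sw_(c1, c2 <- D c) \sw_(c11, c12 <- D c1) F c11 c12 c2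
  = \sw_(c1, c2 <- D c) \sw_(c21, c22 <- D c2) F c1 c21 c22.
Proof.
move=> tF; have E := coalgebra_coassoc coV c.
have {E} := congr1 (sweedler (fun p z => \sw_(x, y <- p) F x y z)) E.
move=> E; nf_from E.
Qed.

(** Two ways of bracketing the fourfold coproduct: [(c_1 c_2)(c_3 c_4)] becomes
    [c_1 ((c_2 c_3) c_4)], which isolates the middle pair. *)
Lemma coassoc4_sweedler (U : lmodType K) (F : V -> V -> V -> V -> U) c :
  trilinear (fun x y z => \sw_(z1, z2 <- D z) F x y z1 z2) ->
  (forall x, trilinear (F x)) ->
  \sw_(c1, c2 <- D c) \sw_(c11, c12 <- D c1) \sw_(c21, c22 <- D c2) F c11 c12 c21 c22
  = \sw_(c1, c2 <- D c) \sw_(d, c4 <- D c2) \sw_(c2, c3 <- D d) F c1 c2 c3 c4.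
Proof.
move=> t1 t2.
rewrite (coassoc_sweedler (F := fun x y z => \sw_(z1, z2 <- D z) F x y z1 z2)) //.
by apply: eq_sweedler => c1 c2; rewrite coassoc_sweedler.
Qed.

Lemma counitl_sweedler (U : lmodType K) (f : V -> U) c : linear f ->
  \sw_(c1, c2 <- D c) eps c1 *: f c2 = f c.
Proof.
move=> lf; rewrite -{2}(coalgebra_counitl coV c) linear_of_sweedler //.
by apply: eq_sweedler => c1 c2; rewrite linear_scaled.
Qed.

Lemma counitr_sweedler (U : lmodType K) (f : V -> U) c : linear f ->
  \sw_(c1, c2 <- D c) eps c2 *: f c1 = f c.
Proof.
move=> lf; rewrite -{2}(coalgebra_counitr coV c) linear_of_sweedler //.
by apply: eq_sweedler => c1 c2; rewrite linear_scaled.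
Qed.
End Coalgebra.

Section LeftComodule.
Variables (K : fieldType) (H : algType K) (DeltaH : H -> H ⊗ H) (epsH : H -> K^o).
Hypothesis lDH : linear DeltaH.
Variables (A : lmodType K) (DeltaA : A -> A ⊗ A) (epsA : A -> K^o) (rhoA : A -> H ⊗ A).
Hypothesis cA : is_left_comodule_coalgebra DeltaH epsH DeltaA epsA rhoA.
Let lD : linear DeltaA. Proof. by case: cA => [[]]. Qed.
Let lr : linear rhoA. Proof. by case: cA => [_ []]. Qed.
Ltac linear_op ::= first [refine (linear_comp lDH _)
  | refine (linear_comp lD _) | refine (linear_comp lr _)].

Lemma lcoact_coassoc_sweedler (U : lmodType K) (F : H -> H -> A -> U) a : trilinear F ->
  \sw_(h, a0 <- rhoA a) \sw_(h1, h2 <- DeltaH h) F h1 h2 a0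
    = \sw_(h, a0 <- rhoA a) \sw_(h', a00 <- rhoA a0) F h h' a00.
Proof.
move=> tF; have E := lcomod_coassoc (lcomodcoalg_comodule cA) a.
have {E} := congr1 (sweedler (fun p z => \sw_(x, y <- p) F x y z)) E.
move=> E; nf_from E.
Qed.

Lemma lcoact_Delta_sweedler (U : lmodType K) (F : H -> A -> A -> U) a : trilinear F ->
  \sw_(h, a0 <- rhoA a) \sw_(a01, a02 <- DeltaA a0) F h a01 a02
    = \sw_(a1, a2 <- DeltaA a) \sw_(h1, a10 <- rhoA a1) \sw_(h2, a20 <- rhoA a2)
        F (h1 * h2) a10 a20.
Proof.
move=> tF; have E := lcomodcoalg_Delta cA a.
have {E} := congr1 (sweedler (fun p z => \sw_(x, y <- p) F x y z)) E.
move=> E; nf_from E.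
Qed.

Lemma lcoact_counit_sweedler (U : lmodType K) (f : A -> U) a : linear f ->
  \sw_(h, a0 <- rhoA a) epsH h *: f a0 = f a.
Proof.
move=> lf; rewrite -{2}(lcomod_counit (lcomodcoalg_comodule cA) a) linear_of_sweedler //.
by apply: eq_sweedler => h a0; rewrite linear_scaled.
Qed.

Lemma lcoact_eps_sweedler (U : lmodType K) (f : H -> U) a : linear f ->
  \sw_(h, a0 <- rhoA a) epsA a0 *: f h = epsA a *: f 1.
Proof.
move=> lf; rewrite -[RHS]linear_scaled // -(lcomodcoalg_eps cA a) linear_of_sweedler //.
by apply: eq_sweedler => h a0; rewrite linear_scaled.
Qed.

(** Coassociativity of the smash coproduct on A, the variables being the five
    factors that depend on [a]: the comodule coalgebra axiom expresses the
    coaction on [a_2] by those on its two parts, and the coaction axiom then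
    turns [Delta m] into an iterated coaction. *)
Lemma lsmash_coassoc (U : lmodType K) (F : A -> H -> A -> H -> A -> U) a :
  pentalinear F ->
  \sw_(a1, a2 <- DeltaA a) \sw_(m, a0 <- rhoA a2) \sw_(a11, a12 <- DeltaA a1)
  \sw_(n, c <- rhoA a12) \sw_(m1, m2 <- DeltaH m) F a11 (n * m1) c m2 a0 =
  \sw_(a1, a2 <- DeltaA a) \sw_(m, a0 <- rhoA a2) \sw_(c, d <- DeltaA a0)
  \sw_(n, d0 <- rhoA d) F a1 m c n d0.
Proof.
move=> pF; etransitivity.
  bring (DeltaA a) ltac:(fun a1 a2 => bring (DeltaA a1)
    ltac:(fun a11 a12 => reflexivity)).
rewrite (coassoc_sweedler (lcomodcoalg_coalgebra cA)); last by lin.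
apply: eq_sweedler => a1 a2.
rewrite (lcoact_Delta_sweedler (F := fun m c d => \sw_(n, d0 <- rhoA d) F a1 m c n d0));
  last by lin.
apply: eq_sweedler => a21 a22; rewrite sweedler_exchange.
apply: eq_sweedler => n c; rewrite lcoact_coassoc_sweedler //; lin.
Qed.
End LeftComodule.

Section RightComodule.
Variables (K : fieldType) (H : algType K) (DeltaH : H -> H ⊗ H) (epsH : H -> K^o).
Variables (B : lmodType K) (DeltaB : B -> B ⊗ B) (epsB : B -> K^o) (rhoB : B -> B ⊗ H).
Hypothesis cB : is_right_comodule_coalgebra DeltaH epsH DeltaB epsB rhoB.
Let lD : linear DeltaB. Proof. by case: cB => [[]]. Qed.
Let lr : linear rhoB. Proof. by case: cB => [_ []]. Qed.
Ltac linear_op ::= first [refine (linear_comp lD _) | refine (linear_comp lr _)].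

Lemma rcoact_coassoc_sweedler (U : lmodType K) (F : B -> H -> H -> U) b : trilinear F ->
  \sw_(b0, h <- rhoB b) \sw_(b00, h' <- rhoB b0) F b00 h' h
    = \sw_(b0, h <- rhoB b) \sw_(h1, h2 <- DeltaH h) F b0 h1 h2.
Proof.
move=> tF; have E := rcomod_coassoc (rcomodcoalg_comodule cB) b.
have {E} := congr1 (sweedler (fun p z => \sw_(x, y <- p) F x y z)) E.
move=> E; nf_from E.
Qed.

Lemma rcoact_Delta_sweedler (U : lmodType K) (F : B -> B -> H -> U) b : trilinear F ->
  \sw_(b0, h <- rhoB b) \sw_(b01, b02 <- DeltaB b0) F b01 b02 h
    = \sw_(b1, b2 <- DeltaB b) \sw_(b10, h1 <- rhoB b1) \sw_(b20, h2 <- rhoB b2)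
        F b10 b20 (h1 * h2).
Proof.
move=> tF; have E := rcomodcoalg_Delta cB b.
have {E} := congr1 (sweedler (fun p z => \sw_(x, y <- p) F x y z)) E.
move=> E; nf_from E.
Qed.

Lemma rcoact_counit_sweedler (U : lmodType K) (f : B -> U) b : linear f ->
  \sw_(b0, h <- rhoB b) epsH h *: f b0 = f b.
Proof.
move=> lf; rewrite -{2}(rcomod_counit (rcomodcoalg_comodule cB) b) linear_of_sweedler //.
by apply: eq_sweedler => b0 h; rewrite linear_scaled.
Qed.

Lemma rcoact_eps_sweedler (U : lmodType K) (f : H -> U) b : linear f ->
  \sw_(b0, h <- rhoB b) epsB b0 *: f h = epsB b *: f 1.
Proof.
move=> lf; rewrite -[RHS]linear_scaled // -(rcomodcoalg_eps cB b) linear_of_sweedler //.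
by apply: eq_sweedler => b0 h; rewrite linear_scaled.
Qed.

(** The mirror image of [lsmash_coassoc]. *)
Lemma rsmash_coassoc (U : lmodType K) (F : B -> H -> B -> H -> B -> U) b :
  pentalinear F ->
  \sw_(b1, b2 <- DeltaB b) \sw_(p, h <- rhoB b1) \sw_(p1, p2 <- DeltaB p)
  \sw_(q, k <- rhoB p1) F q k p2 h b2 =
  \sw_(b1, b2 <- DeltaB b) \sw_(p, h <- rhoB b1) \sw_(h1, h2 <- DeltaH h)
  \sw_(b21, b22 <- DeltaB b2) \sw_(q, k <- rhoB b21) F p h1 q (h2 * k) b22.
Proof.
move=> pF; etransitivity.
  apply: eq_sweedler => b1 b2.
  rewrite (rcoact_Delta_sweedler (F := fun p1 p2 h => \sw_(q, k <- rhoB p1) F q k p2 h b2));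
    last by lin.
  reflexivity.
rewrite (coassoc_sweedler (rcomodcoalg_coalgebra cB)); last by lin.
apply: eq_sweedler => b1 b2; etransitivity.
  bring (rhoB b1) ltac:(fun p1 h1 => bring (rhoB p1) ltac:(fun p q => reflexivity)).
rewrite rcoact_coassoc_sweedler; last by lin.
by [].
Qed.
End RightComodule.

(** * The tensor square of an algebra *)

Section TensorSquare.
Variables (K : fieldType) (V : lmodType K) (one : V) (mul : V -> V -> V).
Hypothesis aV : is_algebra one mul.
Let bM := algebra_bilinear aV.

Lemma tens_mulE v w v' w' : tens_mul mul (v ⊗ w) (v' ⊗ w') = mul v v' ⊗ mul w w'.
Proof. rewrite /tens_mul; nf. Qed.

Lemma bilinear_tens_mul : bilinear2 (tens_mul mul).
Proof. by split=> t; rewrite /tens_mul; lin. Qed.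

Lemma tens_mulA : associative (tens_mul mul).
Proof.
have bT := bilinear_tens_mul.
move=> s t u; move: s; apply: tens_linear_eq; [lin|lin|] => v w.
move: t; apply: tens_linear_eq; [lin|lin|] => v' w'.
move: u; apply: tens_linear_eq; [lin|lin|] => v'' w''.
by rewrite !tens_mulE !(algebra_mulA aV).
Qed.

End TensorSquare.

(** * The two-sided smash product algebra *)

Section SmashProduct.
Variables (K : fieldType) (H : algType K) (DeltaH : H -> H ⊗ H) (epsH : H -> K^o).
Hypothesis bH : is_bialgebra (1 : H) *%R DeltaH epsH.
Let coH := bialgebra_coalgebra bH.
Let lDH : linear DeltaH. Proof. by case: coH. Qed.
Let leH : linear epsH. Proof. by case: coH. Qed.

Lemma DeltaH_mul x y : DeltaH (x * y) =
  \sw_(x1, x2 <- DeltaH x) \sw_(y1, y2 <- DeltaH y) (x1 * y1) ⊗ (x2 * y2).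
Proof. by case: bH => _ _ []. Qed.

Lemma DeltaH1 : DeltaH 1 = 1 ⊗ 1. Proof. by case: bH => _ _ []. Qed.

Variables (A : algType K) (actA : H -> A -> A) (B : algType K) (actB : B -> H -> B).
Hypothesis mA : is_left_module_algebra DeltaH epsH actA.
Hypothesis mB : is_right_module_algebra DeltaH epsH actB.
Let bA : bilinear2 actA. Proof. by case: mA. Qed.
Let bB : bilinear2 actB. Proof. by case: mB. Qed.

Ltac linear_op ::=
  first [ refine (linear_comp lDH _) | refine (linear_comp leH _)
        | refine (linear_comp (bilinear_left bA _) _)
        | refine (linear_comp (bilinear_right bA _) _)
        | refine (linear_comp (bilinear_left bB _) _)
        | refine (linear_comp (bilinear_right bB _) _)].
Ltac nf_atom ::= first [exact: DeltaH_mul | exact: DeltaH1].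

Ltac nf_leaf ::=
  match goal with
  | |- context [actA ?h (?p * ?q)] => nf_expand (actA h (p * q)) (lmodalg_act_mul mA h p q)
  | |- context [actB (?p * ?q) ?h] => nf_expand (actB (p * q) h) (rmodalg_act_mul mB p q h)
  end.

Notation "s ∗ t" := (smash_mul DeltaH actA actB s t) (at level 40, left associativity).

Lemma smash_mulE a x b a' x' b' :
  (a ⊗ x ⊗ b) ∗ (a' ⊗ x' ⊗ b') =
  \sw_(x1, x2 <- DeltaH x) \sw_(x1', x2' <- DeltaH x')
    (a * actA x1 a') ⊗ (x2 * x1') ⊗ (actB b x2' * b').
Proof. rewrite /smash_mul; nf. Qed.

Lemma bilinear_smash_mul : bilinear2 (smash_mul DeltaH actA actB).
Proof. by split=> t; rewrite /smash_mul; lin. Qed.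

Lemma smash_linear_eq (U : lmodType K) (g h : A ⊗ H ⊗ B -> U) :
  linear g -> linear h -> (forall a x b, g (a ⊗ x ⊗ b) = h (a ⊗ x ⊗ b)) -> g =1 h.
Proof.
move=> lg lh e; apply: tens_linear_eq => // t b; move: t.
apply: (tens_linear_eq (g := fun t => g (t ⊗ b)) (h := fun t => h (t ⊗ b))) => //; lin.
Qed.

(** On pure tensors both bracketings become the same sum once the coproducts of
    the three elements of H are bracketed alike. *)
Lemma smash_mulA : associative (smash_mul DeltaH actA actB).
Proof.
have bM := bilinear_smash_mul.
move=> s t u; move: s; apply: smash_linear_eq; [lin|lin|] => a x b.
move: t; apply: smash_linear_eq; [lin|lin|] => a' x' b'.
move: u; apply: smash_linear_eq; [lin|lin|] => a'' x'' b''.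
rewrite /smash_mul.
etransitivity; first by nf.
symmetry; etransitivity; first by nf.
etransitivity.
  bring (DeltaH x') ltac:(fun h k => bring (DeltaH h) ltac:(fun h1 h2 => reflexivity)).
rewrite (coassoc_sweedler coH); last by lin.
symmetry; etransitivity.
  bring (DeltaH x) ltac:(fun h k => bring (DeltaH h) ltac:(fun h1 h2 => reflexivity)).
rewrite (coassoc_sweedler coH); last by lin.
etransitivity.
  bring (DeltaH x'') ltac:(fun h k => bring (DeltaH h) ltac:(fun h1 h2 => reflexivity)).
rewrite (coassoc_sweedler coH); last by lin.
match_sw.
by rewrite !(lmodalg_actM mA) !(rmodalg_actM mB) !mulrA.
Qed.

(** These products are simpler than the general one because the unit absorbs the
    action, which leaves a counit behind. *)
Lemma smash_mul_l a x a' x' b' :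
  (a ⊗ x ⊗ 1) ∗ (a' ⊗ x' ⊗ b') =
  \sw_(x1, x2 <- DeltaH x) (a * actA x1 a') ⊗ (x2 * x') ⊗ b'.
Proof.
rewrite smash_mulE; apply: eq_sweedler => x1 x2.
rewrite -(counitr_sweedler coH (f := fun z => (a * actA x1 a') ⊗ (x2 * z) ⊗ b'));
  last by lin.
apply: eq_sweedler => y1 y2.
by rewrite (rmodalg_act_one mB) -scalerAl mul1r (linear_scaled _ _ (linear_purer _)).
Qed.

Lemma smash_mul_r a x b x' b' :
  (a ⊗ x ⊗ b) ∗ (1 ⊗ x' ⊗ b') =
  \sw_(x1', x2' <- DeltaH x') a ⊗ (x * x1') ⊗ (actB b x2' * b').
Proof.
rewrite smash_mulE sweedler_exchange; apply: eq_sweedler => y1 y2.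
rewrite -(counitl_sweedler coH (f := fun z => a ⊗ (z * y1) ⊗ (actB b y2 * b')));
  last by lin.
apply: eq_sweedler => x1 x2.
by rewrite (lmodalg_act_one mA) -scalerAr mulr1 !(linear_scaled _ _ (linear_purel _)).
Qed.

Lemma smash_mul_lr a x x' b' :
  (a ⊗ x ⊗ 1) ∗ (1 ⊗ x' ⊗ b') = a ⊗ (x * x') ⊗ b'.
Proof.
rewrite smash_mul_l.
rewrite -(counitl_sweedler coH (f := fun z => a ⊗ (z * x') ⊗ b')); last by lin.
apply: eq_sweedler => x1 x2.
by rewrite (lmodalg_act_one mA) -scalerAr mulr1 !(linear_scaled _ _ (linear_purel _)).
Qed.

Lemma smash_algebra : is_algebra smash_one (smash_mul DeltaH actA actB).
Proof.
have bM := bilinear_smash_mul.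
split; [exact: bM | exact: smash_mulA | |]; apply: smash_linear_eq; try lin;
  move=> a x b; rewrite /smash_one.
  rewrite smash_mul_l DeltaH1 sweedler_pure; last by lin.
  by rewrite (lmodalg_act1 mA) !mul1r.
rewrite smash_mul_r DeltaH1 sweedler_pure; last by lin.
by rewrite (rmodalg_act1 mB) !mulr1.
Qed.
End SmashProduct.

(** * The two-sided smash coproduct coalgebra *)

Section SmashCoproduct.
Variables (K : fieldType) (H : algType K) (DeltaH : H -> H ⊗ H) (epsH : H -> K^o).
Hypothesis bH : is_bialgebra (1 : H) *%R DeltaH epsH.
Let coH := bialgebra_coalgebra bH.
Let lDH : linear DeltaH. Proof. by case: coH. Qed.
Let leH : linear epsH. Proof. by case: coH. Qed.

Lemma epsH_mul x y : epsH (x * y) = epsH x * epsH y.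
Proof. by case: bH => _ _ _ []. Qed.

Lemma epsH1 : epsH 1 = 1. Proof. by case: bH => _ _ _ []. Qed.

Variables (A B : algType K).
Variables (DeltaA : A -> A ⊗ A) (epsA : A -> K^o) (rhoA : A -> H ⊗ A).
Variables (DeltaB : B -> B ⊗ B) (epsB : B -> K^o) (rhoB : B -> B ⊗ H).
Hypothesis cA : is_left_comodule_coalgebra DeltaH epsH DeltaA epsA rhoA.
Hypothesis cB : is_right_comodule_coalgebra DeltaH epsH DeltaB epsB rhoB.
Let coA := lcomodcoalg_coalgebra cA.
Let coB := rcomodcoalg_coalgebra cB.
Let lDA : linear DeltaA. Proof. by case: coA. Qed.
Let leA : linear epsA. Proof. by case: coA. Qed.
Let lrA : linear rhoA. Proof. by case: cA => [_ []]. Qed.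
Let lDB : linear DeltaB. Proof. by case: coB. Qed.
Let leB : linear epsB. Proof. by case: coB. Qed.
Let lrB : linear rhoB. Proof. by case: cB => [_ []]. Qed.

Ltac linear_op ::=
  first [ refine (linear_comp lDH _) | refine (linear_comp leH _)
        | refine (linear_comp lDA _) | refine (linear_comp leA _)
        | refine (linear_comp lDB _) | refine (linear_comp leB _)
        | refine (linear_comp lrA _) | refine (linear_comp lrB _) ].
Ltac nf_atom ::= exact: (DeltaH_mul bH).
Ltac nf_sum ::=
  first [ refine (etrans (counitl_sweedler coH _ _) _); [lin|]
        | refine (etrans (counitr_sweedler coH _ _) _); [lin|]
        | refine (etrans (counitl_sweedler coA _ _) _); [lin|]
        | refine (etrans (counitr_sweedler coA _ _) _); [lin|]
        | refine (etrans (counitl_sweedler coB _ _) _); [lin|]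
        | refine (etrans (counitr_sweedler coB _ _) _); [lin|]
        | refine (etrans (lcoact_counit_sweedler cA _ _) _); [lin|]
        | refine (etrans (rcoact_counit_sweedler cB _ _) _); [lin|]
        | refine (etrans (lcoact_eps_sweedler cA _ _) _); [lin|]
        | refine (etrans (rcoact_eps_sweedler cB _ _) _); [lin|] ].

Notation Delta := (smash_Delta DeltaH DeltaA rhoA DeltaB rhoB).
Notation eps := (smash_eps epsH epsA epsB).

Lemma smash_DeltaE a x b : Delta (a ⊗ x ⊗ b) =
  \sw_(a1, a2 <- DeltaA a) \sw_(m, a0 <- rhoA a2) \sw_(x1, x2 <- DeltaH x)
  \sw_(b1, b2 <- DeltaB b) \sw_(b0, h <- rhoB b1)
    (a1 ⊗ (m * x1) ⊗ b0) ⊗ (a0 ⊗ (x2 * h) ⊗ b2).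
Proof. rewrite /smash_Delta; nf. Qed.

Lemma smash_epsE a x b : eps (a ⊗ x ⊗ b) = epsA a * epsH x * epsB b.
Proof. rewrite /smash_eps; nf. Qed.

Lemma linear_smash_Delta : linear Delta. Proof. rewrite /smash_Delta; lin. Qed.

Lemma linear_smash_eps : linear eps. Proof. rewrite /smash_eps; lin. Qed.

Ltac nf_atom ::= first [exact: (DeltaH_mul bH) | exact: smash_DeltaE].
Ltac nf_leaf ::= first [progress rewrite ?mulrA ?mulr1 ?mul1r | rewrite smash_epsE epsH_mul].

(** The factors of H multiply contributions of A, H and B that never mix, so
    coassociativity splits into [lsmash_coassoc], coassociativity of H and
    [rsmash_coassoc]. *)
Lemma smash_coalgebra : is_coalgebra Delta eps.
Proof.
have lD := linear_smash_Delta; have le := linear_smash_eps.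
split=> //.
- apply: smash_linear_eq; [lin|lin|] => a x b.
  rewrite smash_DeltaE.
  etransitivity; first by nf.
  etransitivity.
    bring (DeltaB b) ltac:(fun b1 b2 => bring (rhoB b1) ltac:(fun p h =>
      bring (DeltaB p) ltac:(fun p1 p2 => bring (rhoB p1) ltac:(fun q k =>
      reflexivity)))).
  rewrite (rsmash_coassoc cB); last by lin.
  etransitivity.
    bring (DeltaH x) ltac:(fun x1 x2 => bring (DeltaH x1) ltac:(fun x11 x12 =>
      reflexivity)).
  rewrite (coassoc_sweedler coH); last by lin.
  symmetry; etransitivity; first by nf.
  etransitivity.
    bring (DeltaA a) ltac:(fun a1 a2 => bring (rhoA a2) ltac:(fun m a0 =>
      bring (DeltaA a0) ltac:(fun c d => bring (rhoA d) ltac:(fun n d0 =>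
      reflexivity)))).
  rewrite -(lsmash_coassoc lDH cA); last by lin.
  match_sw; by rewrite !mulrA.
- apply: smash_linear_eq; [lin|lin|] => a x b.
  rewrite smash_DeltaE.
  etransitivity; first by nf.
  etransitivity; first by at_leaf ltac:(rewrite !scaler_mul_rev; reflexivity).
  by nf.
- apply: smash_linear_eq; [lin|lin|] => a x b.
  rewrite smash_DeltaE.
  etransitivity; first by nf.
  etransitivity.
    (* the sum over [rhoB b1] lies inside the one over [DeltaB b], hence the swap *)
    by at_leaf ltac:(rewrite mulrAC !scaler_mul_rev; reflexivity).
  by nf.
Qed.
End SmashCoproduct.

(** * Coproducts of the generators *)

Section SmashBialgebra.
Variables (K : fieldType) (H : algType K) (DeltaH : H -> H ⊗ H) (epsH : H -> K^o).
Hypothesis bH : is_bialgebra (1 : H) *%R DeltaH epsH.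
Let coH := bialgebra_coalgebra bH.
Let lDH : linear DeltaH. Proof. by case: coH. Qed.
Let leH : linear epsH. Proof. by case: coH. Qed.

Variables (A : algType K) (DeltaA : A -> A ⊗ A) (epsA : A -> K^o).
Variables (rhoA : A -> H ⊗ A) (actA : H -> A -> A).
Hypothesis cA : is_left_comodule_coalgebra DeltaH epsH DeltaA epsA rhoA.
Hypothesis epsA1 : epsA 1 = 1.
Hypothesis mA : is_left_module_algebra DeltaH epsH actA.
Variables (B : algType K) (DeltaB : B -> B ⊗ B) (epsB : B -> K^o).
Variables (rhoB : B -> B ⊗ H) (actB : B -> H -> B).
Hypothesis cB : is_right_comodule_coalgebra DeltaH epsH DeltaB epsB rhoB.
Hypothesis epsB1 : epsB 1 = 1.
Hypothesis mB : is_right_module_algebra DeltaH epsH actB.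

Let coA := lcomodcoalg_coalgebra cA.
Let coB := rcomodcoalg_coalgebra cB.
Let lDA : linear DeltaA. Proof. by case: coA. Qed.
Let leA : linear epsA. Proof. by case: coA. Qed.
Let lrA : linear rhoA. Proof. by case: cA => [_ []]. Qed.
Let lDB : linear DeltaB. Proof. by case: coB. Qed.
Let leB : linear epsB. Proof. by case: coB. Qed.
Let lrB : linear rhoB. Proof. by case: cB => [_ []]. Qed.
Let bA : bilinear2 actA. Proof. by case: mA. Qed.
Let bB : bilinear2 actB. Proof. by case: mB. Qed.

Notation mul := (smash_mul DeltaH actA actB).
Notation Delta := (smash_Delta DeltaH DeltaA rhoA DeltaB rhoB).
Notation eps := (smash_eps epsH epsA epsB).
Notation "s ∗ t" := (smash_mul DeltaH actA actB s t) (at level 40, left associativity).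
Notation "s ∗∗ t" := (tens_mul (smash_mul DeltaH actA actB) s t)
  (at level 40, left associativity).

Let aW : is_algebra smash_one mul := smash_algebra bH mA mB.
Let bM : bilinear2 mul := algebra_bilinear aW.
Let bT : bilinear2 (tens_mul mul) := bilinear_tens_mul aW.
Let lD : linear Delta := linear_smash_Delta bH cA cB.
Let le : linear eps := linear_smash_eps bH cA cB.

Ltac linear_op ::=
  first [ refine (linear_comp lDH _) | refine (linear_comp leH _)
        | refine (linear_comp lDA _) | refine (linear_comp leA _)
        | refine (linear_comp lDB _) | refine (linear_comp leB _)
        | refine (linear_comp lrA _) | refine (linear_comp lrB _)
        | refine (linear_comp (bilinear_left bA _) _)
        | refine (linear_comp (bilinear_right bA _) _)
        | refine (linear_comp (bilinear_left bB _) _)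
        | refine (linear_comp (bilinear_right bB _) _)
        | refine (linear_comp (bilinear_left bM _) _)
        | refine (linear_comp (bilinear_right bM _) _)
        | refine (linear_comp (bilinear_left bT _) _)
        | refine (linear_comp (bilinear_right bT _) _)
        | refine (linear_comp lD _) | refine (linear_comp le _) ].
Ltac nf_atom ::= first [ exact: (DeltaH_mul bH) | exact: (DeltaH1 bH) ].

(** The values that [Delta] takes on the copies of A, H and B when the units are
    grouplike and coinvariant.  Taken as definitions, they give the
    factorization [Delta_factor] unconditionally. *)
Definition cogenA a : (A ⊗ H ⊗ B) ⊗ (A ⊗ H ⊗ B) :=
  \sw_(a1, a2 <- DeltaA a) \sw_(m, a0 <- rhoA a2) (a1 ⊗ m ⊗ 1) ⊗ (a0 ⊗ 1 ⊗ 1).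
Definition cogenH x : (A ⊗ H ⊗ B) ⊗ (A ⊗ H ⊗ B) :=
  \sw_(x1, x2 <- DeltaH x) (1 ⊗ x1 ⊗ 1) ⊗ (1 ⊗ x2 ⊗ 1).
Definition cogenB b : (A ⊗ H ⊗ B) ⊗ (A ⊗ H ⊗ B) :=
  \sw_(b1, b2 <- DeltaB b) \sw_(b0, h <- rhoB b1) (1 ⊗ 1 ⊗ b0) ⊗ (1 ⊗ h ⊗ b2).

Ltac nf_leaf ::=
  first
  [ progress rewrite ?mulrA ?mulr1 ?mul1r ?(lmodalg_act1 mA) ?(rmodalg_act1 mB)
      ?(smash_mul_lr bH mA mB)
  | match goal with
    | |- context [(?a ⊗ ?x ⊗ 1) ∗ (?a' ⊗ ?x' ⊗ ?b')] =>
        nf_expand ((a ⊗ x ⊗ 1) ∗ (a' ⊗ x' ⊗ b')) (smash_mul_l bH mA mB a x a' x' b')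
    | |- context [(?a ⊗ ?x ⊗ ?b) ∗ (1 ⊗ ?x' ⊗ ?b')] =>
        nf_expand ((a ⊗ x ⊗ b) ∗ (1 ⊗ x' ⊗ b')) (smash_mul_r bH mA mB a x b x' b')
    | |- context [(?a ⊗ ?x ⊗ ?b) ∗ (?a' ⊗ ?x' ⊗ ?b')] =>
        nf_expand ((a ⊗ x ⊗ b) ∗ (a' ⊗ x' ⊗ b')) (smash_mulE bH mA mB a x b a' x' b')
    end ].

Lemma Delta_factor a x b : Delta (a ⊗ x ⊗ b) = cogenA a ∗∗ cogenH x ∗∗ cogenB b.
Proof.
rewrite (smash_DeltaE bH cA cB) /cogenA /cogenH /cogenB /tens_mul.
symmetry; etransitivity; first by nf.
by [].
Qed.

Lemma cogenH_cogenH x y : cogenH x ∗∗ cogenH y = cogenH (x * y).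
Proof.
rewrite /cogenH /tens_mul; etransitivity; first by nf.
by symmetry; nf.
Qed.

(** * From the conditions to the bialgebra *)

Section Sufficiency.
Hypothesis epsA_mul : forall a a', epsA (a * a') = epsA a * epsA a'.
Hypothesis epsB_mul : forall b b', epsB (b * b') = epsB b * epsB b'.
Hypothesis DeltaA1 : DeltaA 1 = 1 ⊗ 1.
Hypothesis DeltaB1 : DeltaB 1 = 1 ⊗ 1.
Hypothesis rhoA1 : rhoA 1 = 1 ⊗ 1.
Hypothesis rhoB1 : rhoB 1 = 1 ⊗ 1.
Hypothesis epsA_act : forall x a, epsA (actA x a) = epsA a * epsH x.
Hypothesis epsB_act : forall b x, epsB (actB b x) = epsB b * epsH x.
Hypothesis rhoA_mul : forall a a', rhoA (a * a') =
  \sw_(am, a0 <- rhoA a) \sw_(am', a0' <- rhoA a') (am * am') ⊗ (a0 * a0').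
Hypothesis rhoB_mul : forall b b', rhoB (b * b') =
  \sw_(b0, b1 <- rhoB b) \sw_(b0', b1' <- rhoB b') (b0 * b0') ⊗ (b1 * b1').
Hypothesis rhoA_act : forall x a,
  \sw_(x1, x2 <- DeltaH x) \sw_(h, c <- rhoA (actA x1 a)) (h * x2) ⊗ c =
  \sw_(x1, x2 <- DeltaH x) \sw_(am, a0 <- rhoA a) (x1 * am) ⊗ actA x2 a0.
Hypothesis rhoB_act : forall x b,
  \sw_(x1, x2 <- DeltaH x) \sw_(c, h <- rhoB (actB b x2)) c ⊗ (x1 * h) =
  \sw_(x1, x2 <- DeltaH x) \sw_(b0, b1 <- rhoB b) actB b0 x1 ⊗ (b1 * x2).
Hypothesis cross_trivial : forall a b,
  \sw_(am, a0 <- rhoA a) \sw_(b0, b1 <- rhoB b) actA b1 a0 ⊗ actB b0 am = a ⊗ b.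
Hypothesis DeltaA_mul : forall a a', DeltaA (a * a') =
  \sw_(a1, a2 <- DeltaA a) \sw_(a2m, a20 <- rhoA a2) \sw_(a1', a2' <- DeltaA a')
    (a1 * actA a2m a1') ⊗ (a20 * a2').
Hypothesis DeltaB_mul : forall b b', DeltaB (b * b') =
  \sw_(b1, b2 <- DeltaB b) \sw_(b1', b2' <- DeltaB b') \sw_(b10', b11' <- rhoB b1')
    (b1 * b10') ⊗ (actB b2 b11' * b2').
Hypothesis DeltaA_act : forall x a, DeltaA (actA x a) =
  \sw_(x1, x2 <- DeltaH x) \sw_(a1, a2 <- DeltaA a) actA x1 a1 ⊗ actA x2 a2.
Hypothesis DeltaB_act : forall b x, DeltaB (actB b x) =
  \sw_(b1, b2 <- DeltaB b) \sw_(x1, x2 <- DeltaH x) actB b1 x1 ⊗ actB b2 x2.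

Ltac nf_atom ::=
  first [ exact: (DeltaH_mul bH) | exact: (DeltaH1 bH) | exact: DeltaA1 | exact: DeltaB1
        | exact: rhoA1 | exact: rhoB1 | exact: rhoA_mul | exact: rhoB_mul
        | exact: DeltaA_mul | exact: DeltaB_mul | exact: DeltaA_act | exact: DeltaB_act ].

Lemma cogenA_cogenA a a' : cogenA a ∗∗ cogenA a' = cogenA (a * a').
Proof.
rewrite {1 2}/cogenA /tens_mul; etransitivity; first by nf.
etransitivity.
  apply: eq_sweedler => a1 a2; etransitivity.
    bring (rhoA a2) ltac:(fun m a0 => bring (DeltaH m) ltac:(fun m1 m2 => reflexivity)).
  by rewrite (lcoact_coassoc_sweedler cA); last by lin.
symmetry; rewrite /cogenA; etransitivity; first by nf.
by match_sw.
Qed.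

Lemma cogenB_cogenB b b' : cogenB b ∗∗ cogenB b' = cogenB (b * b').
Proof.
rewrite {1 2}/cogenB /tens_mul; etransitivity; first by nf.
symmetry; rewrite /cogenB; etransitivity; first by nf.
etransitivity.
  bring (DeltaB b') ltac:(fun b1 b2 => bring (rhoB b1) ltac:(fun b0 h =>
    bring (rhoB b0) ltac:(fun b00 h' => reflexivity))).
etransitivity.
  apply: eq_sweedler => b1 b2.
  by rewrite (rcoact_coassoc_sweedler cB); last by lin.
by match_sw.
Qed.

Lemma rhoA_act_sweedler (U : lmodType K) (F : H -> A -> U) x a : bilinear2 F ->
  \sw_(x1, x2 <- DeltaH x) \sw_(h, c <- rhoA (actA x1 a)) F (h * x2) c =
  \sw_(x1, x2 <- DeltaH x) \sw_(am, a0 <- rhoA a) F (x1 * am) (actA x2 a0).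
Proof.
by move=> bF; have E := congr1 (sweedler F) (rhoA_act x a); nf_from E.
Qed.

Lemma rhoB_act_sweedler (U : lmodType K) (F : B -> H -> U) x b : bilinear2 F ->
  \sw_(x1, x2 <- DeltaH x) \sw_(c, h <- rhoB (actB b x2)) F c (x1 * h) =
  \sw_(x1, x2 <- DeltaH x) \sw_(b0, b1 <- rhoB b) F (actB b0 x1) (b1 * x2).
Proof.
by move=> bF; have E := congr1 (sweedler F) (rhoB_act x b); nf_from E.
Qed.

Lemma cross_trivial_sweedler (U : lmodType K) (F : A -> B -> U) a b : bilinear2 F ->
  \sw_(am, a0 <- rhoA a) \sw_(b0, b1 <- rhoB b) F (actA b1 a0) (actB b0 am) = F a b.
Proof.
by move=> bF; have E := congr1 (sweedler F) (cross_trivial a b); nf_from E.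
Qed.

(** After [coassoc4_sweedler] the two sides differ only by [rhoA_act] applied to
    the middle pair of the fourfold coproduct of [x]. *)
Lemma cogenH_cogenA x a :
  cogenH x ∗∗ cogenA a = \sw_(x1, x2 <- DeltaH x) cogenA (actA x1 a) ∗∗ cogenH x2.
Proof.
rewrite /cogenH /cogenA /tens_mul; etransitivity; first by nf.
etransitivity.
  bring (DeltaH x) ltac:(fun x1 x2 => bring (DeltaH x1) ltac:(fun x11 x12 =>
    bring (DeltaH x2) ltac:(fun x21 x22 => reflexivity))).
rewrite (coassoc4_sweedler coH); [|lin|move=> ?; lin].
symmetry; etransitivity; first by nf.
etransitivity.
  bring (DeltaH x) ltac:(fun x1 x2 => bring (DeltaH x1) ltac:(fun x11 x12 =>
    bring (DeltaH x2) ltac:(fun x21 x22 => reflexivity))).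
rewrite (coassoc4_sweedler coH); [|lin|move=> ?; lin].
apply: eq_sweedler => x1 y; apply: eq_sweedler => d x4.
rewrite sweedler_exchange; symmetry; rewrite sweedler_exchange; symmetry.
apply: eq_sweedler => a1 a2.
apply: (rhoA_act_sweedler (F := fun h c => (actA x1 a1 ⊗ h ⊗ 1) ⊗ (c ⊗ x4 ⊗ 1))); lin.
Qed.

Lemma cogenB_cogenH b x :
  cogenB b ∗∗ cogenH x = \sw_(x1, x2 <- DeltaH x) cogenH x1 ∗∗ cogenB (actB b x2).
Proof.
rewrite /cogenH /cogenB /tens_mul; etransitivity; first by nf.
etransitivity.
  bring (DeltaH x) ltac:(fun x1 x2 => bring (DeltaH x1) ltac:(fun x11 x12 =>
    bring (DeltaH x2) ltac:(fun x21 x22 => reflexivity))).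
rewrite (coassoc4_sweedler coH); [|lin|move=> ?; lin].
symmetry; etransitivity; first by nf.
etransitivity.
  bring (DeltaH x) ltac:(fun x1 x2 => bring (DeltaH x1) ltac:(fun x11 x12 =>
    bring (DeltaH x2) ltac:(fun x21 x22 => reflexivity))).
rewrite (coassoc4_sweedler coH); [|lin|move=> ?; lin].
apply: eq_sweedler => x1 y; apply: eq_sweedler => d x4.
rewrite sweedler_exchange; symmetry.
etransitivity.
  bring (DeltaB b) ltac:(fun b1 b2 => bring (DeltaH d) ltac:(fun d1 d2 => reflexivity)).
symmetry; apply: eq_sweedler => b1 b2.
apply: (rhoB_act_sweedler (F := fun c h => (1 ⊗ x1 ⊗ c) ⊗ (1 ⊗ h ⊗ actB b2 x4))); lin.
Qed.

(** Coassociativity of the coactions isolates one coaction on [a_2] and one on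
    [b_1], which act on each other as in [cross_trivial]. *)
Lemma cogenB_cogenA b a : cogenB b ∗∗ cogenA a = cogenA a ∗∗ cogenB b.
Proof.
rewrite /cogenA /cogenB /tens_mul; etransitivity; first by nf.
symmetry; etransitivity; first by nf.
symmetry; etransitivity.
  bring (DeltaA a) ltac:(fun a1 a2 => bring (rhoA a2) ltac:(fun m a0 =>
    bring (DeltaH m) ltac:(fun m1 m2 => reflexivity))).
apply: eq_sweedler => a1 a2; rewrite (lcoact_coassoc_sweedler cA); last by lin.
apply: eq_sweedler => m a0; etransitivity.
  bring (DeltaB b) ltac:(fun b1 b2 => bring (rhoB b1) ltac:(fun b0 h =>
    bring (DeltaH h) ltac:(fun h1 h2 => reflexivity))).
apply: eq_sweedler => b1 b2; rewrite -(rcoact_coassoc_sweedler cB); last by lin.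
apply: eq_sweedler => b0 h; rewrite sweedler_exchange.
by apply: (cross_trivial_sweedler
  (F := fun c d => (a1 ⊗ m ⊗ d) ⊗ (c ⊗ h ⊗ b2))); lin.
Qed.

Lemma smash_Delta_one : Delta smash_one = smash_one ⊗ smash_one.
Proof. by rewrite (smash_DeltaE bH cA cB); nf. Qed.

(** A pure tensor is a product of generators, so it suffices to move each
    generator past [Delta] with an arbitrary element on its right. *)
Lemma smash_Delta_mul : {morph Delta : s t / s ∗ t >-> s ∗∗ t}.
Proof.
have TA := tens_mulA aW.
have mulA a t : Delta ((a ⊗ 1 ⊗ 1) ∗ t) = cogenA a ∗∗ Delta t.
  move: t; apply: smash_linear_eq; [lin|lin|] => a' x' b'.
  rewrite (smash_mul_l bH mA mB); etransitivity; first by nf.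
  by rewrite !Delta_factor -cogenA_cogenA -!TA.
have mulH x t : Delta ((1 ⊗ x ⊗ 1) ∗ t) = cogenH x ∗∗ Delta t.
  move: t; apply: smash_linear_eq; [lin|lin|] => a' x' b'.
  rewrite (smash_mul_l bH mA mB) linear_of_sweedler; last by lin.
  rewrite Delta_factor -TA TA cogenH_cogenA.
  rewrite (linear_of_sweedler (g := fun s => s ∗∗ (cogenH x' ∗∗ cogenB b'))); last by lin.
  apply: eq_sweedler => x1 x2.
  by rewrite mul1r Delta_factor -cogenH_cogenH !TA.
have mulB b t : Delta ((1 ⊗ 1 ⊗ b) ∗ t) = cogenB b ∗∗ Delta t.
  move: t; apply: smash_linear_eq; [lin|lin|] => a' x' b'.
  rewrite (smash_mulE bH mA mB) (DeltaH1 bH) sweedler_pure; last by lin.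
  rewrite linear_of_sweedler; last by lin.
  rewrite Delta_factor -TA TA cogenB_cogenA -TA (TA (cogenB b)) cogenB_cogenH.
  rewrite (linear_of_sweedler (g := fun s => cogenA a' ∗∗ (s ∗∗ cogenB b'))); last by lin.
  apply: eq_sweedler => x1 x2.
  by rewrite !mul1r (lmodalg_act1 mA) Delta_factor -cogenB_cogenB !TA.
move=> s t; move: s; apply: smash_linear_eq; [lin|lin|] => a x b.
have -> : a ⊗ x ⊗ b = (a ⊗ 1 ⊗ 1) ∗ (1 ⊗ x ⊗ 1) ∗ (1 ⊗ 1 ⊗ b).
  by rewrite !(smash_mul_lr bH mA mB) mul1r mulr1.
have DB : Delta (1 ⊗ 1 ⊗ b) = cogenB b by rewrite (smash_DeltaE bH cA cB); nf.
by rewrite -!(algebra_mulA aW) !mulA !mulH !mulB DB !TA.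
Qed.

Lemma smash_eps_mul : {morph eps : s t / s ∗ t >-> s * t}.
Proof.
move=> s t; move: s; apply: smash_linear_eq; [lin|lin|] => a x b.
move: t; apply: smash_linear_eq; [lin|lin|] => a' x' b'.
rewrite (smash_mulE bH mA mB) !(smash_epsE bH cA cB) (linear_of_sweedler (g := eps)) //.
etransitivity.
  apply: eq_sweedler => x1 x2; rewrite (linear_of_sweedler (g := eps)); last by lin.
  apply: eq_sweedler => y1 y2.
  rewrite (smash_epsE bH cA cB) epsA_mul epsA_act (epsH_mul bH) epsB_mul epsB_act.
  (* bring the counits of [x1] and [y1] to the front, to be removed in turn *)
  have leaf : (forall p q r s t u v w : K, p * (q * r) * (s * t) * (u * v * w) =
    t * (r * (p * q * s * v * u * w))) by move=> *; ring.
  exact: leaf.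
etransitivity.
  apply: eq_sweedler => x1 x2.
  apply: (counitl_sweedler coH (f := fun y => epsH x1 *
    (epsA a * epsA a' * epsH x2 * epsH y * epsB b * epsB b') : K^o) x'); lin.
etransitivity.
  apply: (counitl_sweedler coH (f := fun y =>
    epsA a * epsA a' * epsH y * epsH x' * epsB b * epsB b' : K^o) x); lin.
have leaf : (forall p q r s u v : K, p * q * r * s * u * v =
  p * r * u * (q * s * v)) by move=> *; ring.
exact: leaf.
Qed.

Lemma smash_bialgebra : is_bialgebra smash_one mul Delta eps.
Proof.
split; [exact: aW | exact: smash_coalgebra | split | split] => //.
- exact: smash_Delta_one.
- exact: smash_Delta_mul.
- by rewrite (smash_epsE bH cA cB) epsA1 epsB1 (epsH1 bH) !mulr1.
- exact: smash_eps_mul.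
Qed.
End Sufficiency.

Lemma smash_mul_A a a' x' b' : (a ⊗ 1 ⊗ 1) ∗ (a' ⊗ x' ⊗ b') = (a * a') ⊗ x' ⊗ b'.
Proof.
rewrite (smash_mul_l bH mA mB) (DeltaH1 bH) sweedler_pure; last by lin.
by rewrite (lmodalg_act1 mA) mul1r.
Qed.

Lemma smash_mul_B a x b b' : (a ⊗ x ⊗ b) ∗ (1 ⊗ 1 ⊗ b') = a ⊗ x ⊗ (b * b').
Proof.
rewrite (smash_mul_r bH mA mB) (DeltaH1 bH) sweedler_pure; last by lin.
by rewrite (rmodalg_act1 mB) mulr1.
Qed.

(** * From the bialgebra to the conditions *)

Section Necessity.
Hypothesis bW : is_bialgebra smash_one mul Delta eps.

Let epsW s t : eps (s ∗ t) = eps s * eps t.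
Proof. by have [_ _ ->] := bialgebra_eps bW. Qed.

Let DeltaW s t : Delta (s ∗ t) = Delta s ∗∗ Delta t.
Proof. by have [_ _ ->] := bialgebra_Delta bW. Qed.

Let epsE := (smash_epsE bH cA cB, epsA1, epsB1, epsH1 bH, mulr1, mul1r).

Lemma epsA_mul a a' : epsA (a * a') = epsA a * epsA a'.
Proof.
have := epsW (a ⊗ 1 ⊗ 1) (a' ⊗ 1 ⊗ 1).
by rewrite smash_mul_A !epsE.
Qed.

Lemma epsB_mul b b' : epsB (b * b') = epsB b * epsB b'.
Proof.
have := epsW (1 ⊗ 1 ⊗ b) (1 ⊗ 1 ⊗ b').
by rewrite smash_mul_B !epsE.
Qed.

Lemma epsA_act x a : epsA (actA x a) = epsA a * epsH x.
Proof.
have := epsW (1 ⊗ x ⊗ 1) (a ⊗ 1 ⊗ 1).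
rewrite (smash_mul_l bH mA mB) !epsE mulrC => <-.
rewrite (linear_of_sweedler (g := eps)) //.
rewrite -(counitr_sweedler coH (f := fun z => epsA (actA z a))); last by lin.
by apply: eq_sweedler => x1 x2; rewrite !epsE mulrC.
Qed.

Lemma epsB_act b x : epsB (actB b x) = epsB b * epsH x.
Proof.
have := epsW (1 ⊗ 1 ⊗ b) (1 ⊗ x ⊗ 1).
rewrite (smash_mul_r bH mA mB) !epsE => <-.
rewrite (linear_of_sweedler (g := eps)) //.
rewrite -(counitl_sweedler coH (f := fun z => epsB (actB b z))); last by lin.
by apply: eq_sweedler => x1 x2; rewrite !epsE.
Qed.

(** The linear map on the tensor square induced by [F].  Below, [F] applies counits
    to four of its arguments and keeps the other two. *)
Definition smash_test (U : lmodType K) (F : A -> H -> B -> A -> H -> B -> U)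
    (t : (A ⊗ H ⊗ B) ⊗ (A ⊗ H ⊗ B)) : U :=
  \sw_(s, s' <- t) \sw_(ax, b <- s) \sw_(a, x <- ax)
  \sw_(ax', b' <- s') \sw_(a', x' <- ax') F a x b a' x' b'.

Ltac nf_leaf ::=
  first
  [ progress rewrite ?mulrA ?mulr1 ?mul1r ?(lmodalg_act1 mA) ?(rmodalg_act1 mB)
      ?(smash_mul_lr bH mA mB) ?epsA1 ?epsB1 ?(epsH1 bH) ?(epsH_mul bH)
      ?epsA_mul ?epsB_mul ?epsA_act ?epsB_act -?scalerA ?scale1r
  | match goal with
    | |- context [(?a ⊗ ?x ⊗ 1) ∗ (?a' ⊗ ?x' ⊗ ?b')] =>
        nf_expand ((a ⊗ x ⊗ 1) ∗ (a' ⊗ x' ⊗ b')) (smash_mul_l bH mA mB a x a' x' b')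
    | |- context [(?a ⊗ ?x ⊗ ?b) ∗ (1 ⊗ ?x' ⊗ ?b')] =>
        nf_expand ((a ⊗ x ⊗ b) ∗ (1 ⊗ x' ⊗ b')) (smash_mul_r bH mA mB a x b x' b')
    | |- context [(?a ⊗ ?x ⊗ ?b) ∗ (?a' ⊗ ?x' ⊗ ?b')] =>
        nf_expand ((a ⊗ x ⊗ b) ∗ (a' ⊗ x' ⊗ b')) (smash_mulE bH mA mB a x b a' x' b')
    end ].
Ltac nf_sum ::=
  first [ refine (etrans (counitl_sweedler coH _ _) _); [lin|]
        | refine (etrans (counitr_sweedler coH _ _) _); [lin|]
        | refine (etrans (counitl_sweedler coA _ _) _); [lin|]
        | refine (etrans (counitr_sweedler coA _ _) _); [lin|]
        | refine (etrans (counitl_sweedler coB _ _) _); [lin|]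
        | refine (etrans (counitr_sweedler coB _ _) _); [lin|]
        | refine (etrans (lcoact_counit_sweedler cA _ _) _); [lin|]
        | refine (etrans (rcoact_counit_sweedler cB _ _) _); [lin|]
        | refine (etrans (lcoact_eps_sweedler cA _ _) _); [lin|]
        | refine (etrans (rcoact_eps_sweedler cB _ _) _); [lin|]
        | refine (etrans (sweedler_eta _) _)
        | refine (etrans (sweedler_scaler _ _ _) _) ].

Let Delta_one : 
  \sw_(a1, a2 <- DeltaA 1) \sw_(m, a0 <- rhoA a2) 
  \sw_(b1, b2 <- DeltaB 1) \sw_(b0, h <- rhoB b1)
    (a1 ⊗ m ⊗ b0) ⊗ (a0 ⊗ h ⊗ b2) = (1 ⊗ 1 ⊗ 1) ⊗ (1 ⊗ 1 ⊗ 1).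
Proof.
have [_ D1 _] := bialgebra_Delta bW; rewrite -[RHS]D1.
by rewrite (smash_DeltaE bH cA cB); symmetry; nf.
Qed.

Notation eH x := (epsH x : K).
Notation eA a := (epsA a : K).
Notation eB b := (epsB b : K).

(** The counits in the test functions are ordered so that each sum, from the
    innermost outwards, finds at the head of its summand either its own counit
    or a scalar that can be moved out of it. *)
Lemma DeltaA1 : DeltaA 1 = 1 ⊗ 1.
Proof.
have E := congr1 (smash_test (fun a x b a' x' b' =>
  eH x' *: (eB b *: (eB b' *: (eH x *: (a ⊗ a')))))) Delta_one.
rewrite /smash_test in E.
nf_from E.
Qed.

Lemma rhoA1 : rhoA 1 = 1 ⊗ 1.
Proof.
have E := congr1 (smash_test (fun a x b a' x' b' =>
  eH x' *: (eB b *: (eB b' *: (eA a *: (x ⊗ a')))))) Delta_one.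
rewrite /smash_test in E.
nf_from E.
Qed.

Lemma DeltaB1 : DeltaB 1 = 1 ⊗ 1.
Proof.
have E := congr1 (smash_test (fun a x b a' x' b' =>
  eH x' *: (eH x *: (eA a' *: (eA a *: (b ⊗ b')))))) Delta_one.
rewrite /smash_test in E.
nf_from E.
Qed.

Lemma rhoB1 : rhoB 1 = 1 ⊗ 1.
Proof.
have E := congr1 (smash_test (fun a x b a' x' b' =>
  eB b' *: (eH x *: (eA a' *: (eA a *: (b ⊗ x')))))) Delta_one.
rewrite /smash_test in E.
nf_from E.

Qed.

Ltac nf_atom ::=
  first [ exact: (DeltaH_mul bH) | exact: (DeltaH1 bH) | exact: DeltaA1 | exact: DeltaB1
        | exact: rhoA1 | exact: rhoB1 | exact: (smash_DeltaE bH cA cB)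
        | exact: (smash_mul_lr bH mA mB) | exact: (smash_mul_l bH mA mB)
        | exact: (smash_mul_r bH mA mB) | exact: (smash_mulE bH mA mB) ].

Let Delta_A a : Delta (a ⊗ 1 ⊗ 1) = cogenA a.
Proof. by rewrite (smash_DeltaE bH cA cB) /cogenA; nf. Qed.

Let Delta_H x : Delta (1 ⊗ x ⊗ 1) = cogenH x.
Proof. by rewrite (smash_DeltaE bH cA cB) /cogenH; nf. Qed.

Let Delta_B b : Delta (1 ⊗ 1 ⊗ b) = cogenB b.
Proof. by rewrite (smash_DeltaE bH cA cB) /cogenB; nf. Qed.

Let cogenA_cogenA' a a' : cogenA a ∗∗ cogenA a' = cogenA (a * a').
Proof. by rewrite -!Delta_A -DeltaW smash_mul_A. Qed.

Let cogenB_cogenB' b b' : cogenB b ∗∗ cogenB b' = cogenB (b * b').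
Proof. by rewrite -!Delta_B -DeltaW smash_mul_B. Qed.

Let cogenH_cogenA' x a :
  cogenH x ∗∗ cogenA a = \sw_(x1, x2 <- DeltaH x) Delta (actA x1 a ⊗ x2 ⊗ 1).
Proof.
rewrite -Delta_A -Delta_H -DeltaW (smash_mul_l bH mA mB) linear_of_sweedler //.
by apply: eq_sweedler => x1 x2; rewrite mul1r mulr1.
Qed.

Let cogenB_cogenH' b x :
  cogenB b ∗∗ cogenH x = \sw_(x1, x2 <- DeltaH x) Delta (1 ⊗ x1 ⊗ actB b x2).
Proof.
rewrite -Delta_B -Delta_H -DeltaW (smash_mul_r bH mA mB) linear_of_sweedler //.
by apply: eq_sweedler => x1 x2; rewrite mul1r mulr1.
Qed.

Let cogenB_cogenA' b a : cogenB b ∗∗ cogenA a = Delta (a ⊗ 1 ⊗ b).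
Proof.
rewrite -Delta_A -Delta_B -DeltaW (smash_mulE bH mA mB) (DeltaH1 bH).
congr (Delta _); etransitivity; first by nf.
by [].
Qed.

Lemma DeltaA_mul a a' : DeltaA (a * a') =
  \sw_(a1, a2 <- DeltaA a) \sw_(a2m, a20 <- rhoA a2) \sw_(a1', a2' <- DeltaA a')
    (a1 * actA a2m a1') ⊗ (a20 * a2').
Proof.
have E := congr1 (smash_test (fun a x b a' x' b' =>
  eH x' *: (eB b *: (eB b' *: (eH x *: (a ⊗ a')))))) (cogenA_cogenA' a a').
rewrite /smash_test /cogenA /tens_mul in E.
by symmetry; nf_from E.
Qed.

Lemma rhoA_mul a a' : rhoA (a * a') =
  \sw_(am, a0 <- rhoA a) \sw_(am', a0' <- rhoA a') (am * am') ⊗ (a0 * a0').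
Proof.
have E := congr1 (smash_test (fun a x b a' x' b' =>
  eH x' *: (eB b *: (eB b' *: (eA a *: (x ⊗ a')))))) (cogenA_cogenA' a a').
rewrite /smash_test /cogenA /tens_mul in E.
by symmetry; nf_from E.
Qed.

Lemma DeltaB_mul b b' : DeltaB (b * b') =
  \sw_(b1, b2 <- DeltaB b) \sw_(b1', b2' <- DeltaB b') \sw_(b10', b11' <- rhoB b1')
    (b1 * b10') ⊗ (actB b2 b11' * b2').
Proof.
have E := congr1 (smash_test (fun a x b a' x' b' =>
  eH x' *: (eH x *: (eA a' *: (eA a *: (b ⊗ b')))))) (cogenB_cogenB' b b').
rewrite /smash_test /cogenB /tens_mul in E.
by symmetry; nf_from E.
Qed.

Lemma rhoB_mul b b' : rhoB (b * b') =
  \sw_(b0, b1 <- rhoB b) \sw_(b0', b1' <- rhoB b') (b0 * b0') ⊗ (b1 * b1').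
Proof.
have E := congr1 (smash_test (fun a x b a' x' b' =>
  eB b' *: (eH x *: (eA a' *: (eA a *: (b ⊗ x')))))) (cogenB_cogenB' b b').
rewrite /smash_test /cogenB /tens_mul in E.
by symmetry; nf_from E.
Qed.

Lemma DeltaA_act x a : DeltaA (actA x a) =
  \sw_(x1, x2 <- DeltaH x) \sw_(a1, a2 <- DeltaA a) actA x1 a1 ⊗ actA x2 a2.
Proof.
have E := congr1 (smash_test (fun a x b a' x' b' =>
  eH x' *: (eB b *: (eB b' *: (eH x *: (a ⊗ a')))))) (cogenH_cogenA' x a).
rewrite /smash_test /cogenA /cogenH /tens_mul in E.
by symmetry; nf_from E.
Qed.

Lemma rhoA_act x a :
  \sw_(x1, x2 <- DeltaH x) \sw_(h, c <- rhoA (actA x1 a)) (h * x2) ⊗ c =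
  \sw_(x1, x2 <- DeltaH x) \sw_(am, a0 <- rhoA a) (x1 * am) ⊗ actA x2 a0.
Proof.
have E := congr1 (smash_test (fun a x b a' x' b' =>
  eH x' *: (eB b *: (eB b' *: (eA a *: (x ⊗ a')))))) (cogenH_cogenA' x a).
rewrite /smash_test /cogenA /cogenH /tens_mul in E.
by symmetry; nf_from E.
Qed.

Lemma DeltaB_act b x : DeltaB (actB b x) =
  \sw_(b1, b2 <- DeltaB b) \sw_(x1, x2 <- DeltaH x) actB b1 x1 ⊗ actB b2 x2.
Proof.
have E := congr1 (smash_test (fun a x b a' x' b' =>
  eH x' *: (eH x *: (eA a' *: (eA a *: (b ⊗ b')))))) (cogenB_cogenH' b x).
rewrite /smash_test /cogenB /cogenH /tens_mul in E.
by symmetry; nf_from E.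
Qed.

Lemma rhoB_act x b :
  \sw_(x1, x2 <- DeltaH x) \sw_(c, h <- rhoB (actB b x2)) c ⊗ (x1 * h) =
  \sw_(x1, x2 <- DeltaH x) \sw_(b0, b1 <- rhoB b) actB b0 x1 ⊗ (b1 * x2).
Proof.
have E := congr1 (smash_test (fun a x b a' x' b' =>
  eB b' *: (eH x *: (eA a' *: (eA a *: (b ⊗ x')))))) (cogenB_cogenH' b x).
rewrite /smash_test /cogenB /cogenH /tens_mul in E.
symmetry; rewrite sweedler_exchange; by nf_from E.
Qed.

Lemma cross_trivial a b :
  \sw_(am, a0 <- rhoA a) \sw_(b0, b1 <- rhoB b) actA b1 a0 ⊗ actB b0 am = a ⊗ b.
Proof.
have E := congr1 (smash_test (fun a x b a' x' b' =>
  eH x' *: (eB b' *: (eH x *: (eA a *: (a' ⊗ b)))))) (cogenB_cogenA' b a).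
rewrite /smash_test /cogenA /cogenB /tens_mul in E.
by rewrite sweedler_exchange; nf_from E.
Qed.
End Necessity.

End SmashBialgebra.

Theorem corollary3p6
  (K : fieldType)
  (H : algType K) (DeltaH : H -> H ⊗ H) (epsH : H -> K^o)
  (H_bialgebra : is_bialgebra (1 : H) *%R DeltaH epsH)
  (A : algType K) (DeltaA : A -> A ⊗ A) (epsA : A -> K^o)
  (rhoA : A -> H ⊗ A) (actA : H -> A -> A)
  (A_comodule_coalgebra : is_left_comodule_coalgebra DeltaH epsH DeltaA epsA rhoA)
  (epsA_one : epsA 1 = 1)
  (A_module_algebra : is_left_module_algebra DeltaH epsH actA)
  (B : algType K) (DeltaB : B -> B ⊗ B) (epsB : B -> K^o)
  (rhoB : B -> B ⊗ H) (actB : B -> H -> B)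
  (B_comodule_coalgebra : is_right_comodule_coalgebra DeltaH epsH DeltaB epsB rhoB)
  (epsB_one : epsB 1 = 1)
  (B_module_algebra : is_right_module_algebra DeltaH epsH actB) :
  is_bialgebra (smash_one : A ⊗ H ⊗ B)
    (smash_mul DeltaH actA actB)
    (smash_Delta DeltaH DeltaA rhoA DeltaB rhoB)
    (smash_eps epsH epsA epsB)
  <->
  (* C1 *)
  (is_algebra_map (1 : A) *%R (1 : K^o) *%R epsA /\
   is_algebra_map (1 : B) *%R (1 : K^o) *%R epsB) /\
  (* C2 *)
  (DeltaA 1 = 1 ⊗ 1 /\ DeltaB 1 = 1 ⊗ 1) /\
  (* C3 *)
  (rhoA 1 = 1 ⊗ 1 /\ rhoB 1 = 1 ⊗ 1) /\
  (* C4 *)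
  ((forall x a, epsA (actA x a) = epsA a * epsH x) /\
   (forall b x, epsB (actB b x) = epsB b * epsH x)) /\
  (* D8 *)
  (forall a a', rhoA (a * a') =
     \sw_(am, a0 <- rhoA a) \sw_(am', a0' <- rhoA a') (am * am') ⊗ (a0 * a0')) /\
  (* D10 *)
  (forall b b', rhoB (b * b') =
     \sw_(b0, b1 <- rhoB b) \sw_(b0', b1' <- rhoB b') (b0 * b0') ⊗ (b1 * b1')) /\
  (* D16 *)
  (forall x a,
     \sw_(x1, x2 <- DeltaH x) \sw_(h, c <- rhoA (actA x1 a)) (h * x2) ⊗ c =
     \sw_(x1, x2 <- DeltaH x) \sw_(am, a0 <- rhoA a) (x1 * am) ⊗ actA x2 a0) /\
  (* D17 *)
  (forall x b,
     \sw_(x1, x2 <- DeltaH x) \sw_(c, h <- rhoB (actB b x2)) c ⊗ (x1 * h) =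
     \sw_(x1, x2 <- DeltaH x) \sw_(b0, b1 <- rhoB b) actB b0 x1 ⊗ (b1 * x2)) /\
  (* D21 *)
  (forall a b,
     \sw_(am, a0 <- rhoA a) \sw_(b0, b1 <- rhoB b) actA b1 a0 ⊗ actB b0 am = a ⊗ b) /\
  (* F1 *)
  (forall a a', DeltaA (a * a') =
     \sw_(a1, a2 <- DeltaA a) \sw_(a2m, a20 <- rhoA a2) \sw_(a1', a2' <- DeltaA a')
       (a1 * actA a2m a1') ⊗ (a20 * a2')) /\
  (* F2 *)
  (forall b b', DeltaB (b * b') =
     \sw_(b1, b2 <- DeltaB b) \sw_(b1', b2' <- DeltaB b') \sw_(b10', b11' <- rhoB b1')
       (b1 * b10') ⊗ (actB b2 b11' * b2')) /\
  (* F3 *)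
  (forall x a, DeltaA (actA x a) =
     \sw_(x1, x2 <- DeltaH x) \sw_(a1, a2 <- DeltaA a) actA x1 a1 ⊗ actA x2 a2) /\
  (* F4 *)
  (forall b x, DeltaB (actB b x) =
     \sw_(b1, b2 <- DeltaB b) \sw_(x1, x2 <- DeltaH x) actB b1 x1 ⊗ actB b2 x2).
Proof.
split=> [bW | [[[_ _ epsA_mul] [_ _ epsB_mul]] [[? ?] [[? ?] [[? ?]
    [? [? [? [? [? [? [? [? ?]]]]]]]]]]]]]; last exact: smash_bialgebra.
have [[_ lepsA _ _ _] [_ lepsB _ _ _]] := (lcomodcoalg_coalgebra A_comodule_coalgebra,
  rcomodcoalg_coalgebra B_comodule_coalgebra).
split; first by split; split=> //; [exact: epsA_mul bW | exact: epsB_mul bW].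
split; first by split; [exact: DeltaA1 bW | exact: DeltaB1 bW].
split; first by split; [exact: rhoA1 bW | exact: rhoB1 bW].
split; first by split; [exact: epsA_act bW | exact: epsB_act bW].
split; first exact: rhoA_mul bW.
split; first exact: rhoB_mul bW.
split; first exact: rhoA_act bW.
split; first exact: rhoB_act bW.
split; first exact: cross_trivial bW.
split; first exact: DeltaA_mul bW.
split; first exact: DeltaB_mul bW.
split; first exact: DeltaA_act bW.
exact: DeltaB_act bW.
Qed.
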